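(* For $n\ge 3$ the following three statements are equivalent. (i) $n$ is a power of an odd prime or $n$ is the product of at most $3$ (not necessarily distinct) odd primes. (ii) For every $E\subseteq\mathbb{Z}_n$, the support of $\widehat{\chi_E}$ is an extendable domain. (iii) If for some nonempty $E\subseteq\mathbb{Z}_n$ and some $g:\mathbb{Z}_n\to\mathbb{R}$ the functions $\chi_E$ and $g$ have the same $3$-deck, then they are translates of each other (i.e. $g(x)=\chi_E(x-t)$ for all $x$, for some $t\in\mathbb{Z}_n$).
   Context: For $f:\mathbb{Z}_n\to\mathbb{R}$, the $3$-deck is $N_{f,3}(x_1,x_2)=\sum_{x\in\mathbb{Z}_n} f(x)f(x+x_1)f(x+x_2)$. The Fourier transform of $f:\mathbb{Z}_n\to\mathbb{C}$ is $\widehat f(k)=\sum_{j=0}^{n-1}f(j)e^{-2\pi i jk/n}$, $k\in\mathbb{Z}_n$, and $\mathrm{supp}\,\widehat f=\{k:\widehat f(k)\ne0\}$. A set $A\subseteq\mathbb{Z}_n$ is an extendable domain if for every function $h:A\to\mathbb{R}/\mathbb{Z}$ that is additive (i.e. $h(x+y)=h(x)+h(y)$ whenever $x,y,x+y\in A$) there exists $L\in\mathbb{R}$ with $h(k)=Lk \pmod 1$ for every $k\in A$. *)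

(* Defs.v *)
From mathcomp Require Import all_boot all_order all_algebra.
From mathcomp Require Import generic_quotient ring_quotient complex.
From mathcomp Require Import reals trigo.

Set Implicit Arguments.
Unset Strict Implicit.
Unset Printing Implicit Defensive.

Import Order.TTheory GRing.Theory Num.Theory.
Import Quotient.Exports.

Local Open Scope ring_scope.
Local Open Scope complex_scope.
Local Open Scope quotient_scope.

(* The library type 'Z_n is the integers mod n only when n > 1. *)

(* The subgroup Z of R; Num.int_num_subdef is the predicate behind Num.int. *)
Definition integers (R : realType) : zmodClosed R :=
  GRing.ZmodClosed.clone R (@Num.int_num_subdef R) _.

Notation circle R := (Quotient.quot (integers R)).

Definition mod1 (R : realType) (x : R) : circle R := \pi_(circle R) x.

(* e^(i t) *)
Definition expi (R : realType) (t : R) : R[i] := cos t +i* sin t.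

Definition chi (R : realType) (n : nat) (E : {set 'Z_n}) (x : 'Z_n) : R :=
  (x \in E)%:R.

Definition deck3 (R : realType) (n : nat) (f : 'Z_n -> R) (x1 x2 : 'Z_n) : R :=
  \sum_(x : 'Z_n) f x * f (x + x1) * f (x + x2).

(* In j%:R and k%:R the residues are read as their representatives in
   {0, ..., n-1}. *)
Definition fourier (R : realType) (n : nat) (f : 'Z_n -> R[i]) (k : 'Z_n) :
    R[i] :=
  \sum_(j : 'Z_n) f j * expi (- (2 * pi * j%:R * k%:R / n%:R)).

Definition fourier_supp (R : realType) (n : nat) (f : 'Z_n -> R[i]) :
    {set 'Z_n} :=
  [set k | fourier f k != 0].

(* The values of h outside A are irrelevant, so h is taken total. *)
Definition additive_on (R : realType) (n : nat) (A : {set 'Z_n})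
    (h : 'Z_n -> circle R) : Prop :=
  forall x y : 'Z_n, x \in A -> y \in A -> x + y \in A ->
  h (x + y) = h x + h y.

(* For a real L, the product L k needs an integer representative of k; as in
   the Fourier transform it is the one in {0, ..., n-1}. If A = -A and 0 \in A,
   as for the support of the transform of the indicator of a nonempty set, then
   h 0 = 0 and h (- k) = - h k on A, so n L is an integer as soon as A contains
   a nonzero residue, and the choice of representatives does not matter. *)
Definition extendable (R : realType) (n : nat) (A : {set 'Z_n}) : Prop :=
  forall h : 'Z_n -> circle R, additive_on A h ->
  exists L : R, forall k : 'Z_n, k \in A -> h k = mod1 (L * k%:R).

Arguments chi R {n} E x.
Arguments extendable R {n} A.

Definition odd_prime (p : nat) : bool := odd p && prime p.

(* Main.v *)
(** Let A be the support of the transform F of the indicator of E.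

    Taking transforms, equality of 3-decks says that the products
    F(k) F(l) F(-k-l) and G(k) G(l) G(-k-l) agree. Hence G = F u on A with u
    unimodular and multiplicative where it makes sense, that is u = e^(2 pi i h)
    with h additive on A, and g is a translate exactly when h is linear.

    If n is even, E = [0, n/2) has all odd residues and 0 as support, and there
    the only constraints on h are h(0) = 0 and h(-k) = -h(k). If n = pqrs with
    p and q coprime, an interleaving of two periodic sets has a support that
    contains p and q and lies in pZ u qZ, and meets pqZ only in pqsZ, so
    that h(k) = k/(pqs) on qZ and h(k) = 0 elsewhere is additive.

    Conversely let n be odd. By irreducibility of the cyclotomic polynomials A
    is a union of classes {k : gcd(k, n) = d}, and on each such class an additive
    h is linear, with a slope defined modulo n/d. The slopes glue by the Chinese
    remainder theorem when those of d and d' agree modulo n/lcm(d, d'), which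
    holds if lcm(d, d') is in A. For a prime power this is always so. For at most
    three primes the exception is d = p, d' = q, n = pqr, pq not in A. If 1 is
    in A, or r is and differs from p and q, relations through that class give the congruence. Otherwise every
    nonzero k in A is divisible by exactly one of p and q, and a 0-1 valued
    function with such a spectrum has period n/p or n/q, which removes the class
    of q or of p from A. *)

Require Import Defs.
From mathcomp Require Import all_boot all_order all_algebra all_field.
From mathcomp Require Import zify ring lra.
From mathcomp Require Import generic_quotient ring_quotient complex.
From mathcomp Require Import reals trigo.

Set Implicit Arguments.
Unset Strict Implicit.
Unset Printing Implicit Defensive.

Import Order.TTheory GRing.Theory Num.Theory.
Local Open Scope ring_scope.

Lemma coprimezP (n : nat) (x : int) : (0 < n)%N ->
  reflect (forall q : nat, prime q -> (q %| n)%N -> ~~ (q %| x)%Z)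
          (coprimez x n).
Proof.
move=> n0; rewrite coprimezE absz_nat; apply: (iffP idP) => [cop q pq qn|H].
  rewrite dvdzE absz_nat; apply/negP => qx.
  have : (q %| gcdn `|x| n)%N by rewrite dvdn_gcd qx.
  by rewrite (eqP cop) dvdn1 => /eqP q1; rewrite q1 in pq.
apply/negPn/negP => ncop.
have g1 : (1 < gcdn `|x| n)%N by rewrite ltn_neqAle eq_sym ncop gcdn_gt0 n0 orbT.
have := H _ (pdiv_prime g1) (dvdn_trans (pdiv_dvd _) (dvdn_gcdr _ _)).
by rewrite dvdzE absz_nat (dvdn_trans (pdiv_dvd _) (dvdn_gcdl _ _)).
Qed.

Lemma exists_residues (s : seq nat) (c : nat -> int) :
  uniq s -> all prime s ->
  exists x : int, forall q : nat, q \in s -> (q %| x - c q)%Z.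
Proof.
elim: s => [|p s IH] /=; first by exists 0.
case/andP=> ps us /andP[pp aps].
have [x Hx] := IH us aps.
have cop : coprimez p (\prod_(q <- s) q)%N.
  rewrite coprimezE !absz_nat ?big_cons.
  elim: s ps aps {IH us x Hx} => [|q s IHs] /=; first by rewrite big_nil coprimen1.
  rewrite inE negb_or => /andP[pq ps] /andP[qp aps].
  by rewrite big_cons coprimeMr IHs // andbT prime_coprime // dvdn_prime2.
exists (zchinese p (\prod_(q <- s) q)%N (c p) x) => q.
rewrite inE => /orP[/eqP->|qs].
  by rewrite -eqz_mod_dvd; apply/eqP/zchinese_modl.
have h2 := zchinese_modr cop (c p) x.
rewrite -[_ - c q](subrKA x) rpredD ?Hx //.
apply: (@dvdz_trans (\prod_(q <- s) q)%N).
  by rewrite dvdzE !absz_nat (big_rem q) //= dvdn_mulr.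
by rewrite -eqz_mod_dvd; apply/eqP.
Qed.

Lemma exists_avoiding (n : nat) (s : seq int) : (0 < n)%N ->
  (forall q : nat, prime q -> (q %| n)%N ->
     exists c : int, forall y, y \in s -> ~~ (q %| c - y)%Z) ->
  exists x : int, forall y, y \in s -> coprimez (x - y) n.
Proof.
move=> n0 H.
have [c Hc] : exists c : nat -> int, forall q, q \in primes n ->
    forall y, y \in s -> ~~ (q %| c q - y)%Z.
  have : forall q, q \in primes n -> exists z : int,
      all (fun y => ~~ (q %| z - y)%Z) s.
    move=> q; rewrite mem_primes => /and3P[qp _ qn].
    by have [z Hz] := H q qp qn; exists z; apply/allP.
  elim: (primes n) => [|p t IH] H1; first by exists (fun=> 0).
  have [|c Hc] := IH; first by move=> q qt; apply: H1; rewrite inE qt orbT.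
  have [z Hz] := H1 p (mem_head _ _).
  exists (fun q => if q == p then z else c q) => q; rewrite inE.
  case: eqP => [-> _ y ys|_ /= qt]; first exact: (allP Hz).
  exact: Hc.
have [|x Hx] := @exists_residues (primes n) c (primes_uniq n).
  by apply/allP => q; rewrite mem_primes => /andP[].
exists x => y ys; apply/coprimezP => // q pq qn.
have qn' : q \in primes n by rewrite mem_primes pq n0.
apply: contra (Hc q qn' y ys) => qxy.
have -> : c q - y = (x - y) - (x - c q) by ring.
by rewrite rpredB // Hx.
Qed.

Lemma exists_nonresidue (q : nat) (s : seq int) : (size s < q)%N ->
  exists c : int, forall y, y \in s -> ~~ (q %| c - y)%Z.
Proof.
move=> ltsq; have q0 : (0 < q)%N by apply: leq_ltn_trans ltsq.
set t := [seq `|(y %% q)%Z|%N | y <- s].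
have [/allP sub|] := boolP (all (fun i => i \in t) (iota 0 q)).
  have := uniq_leq_size (iota_uniq 0 q) sub.
  by rewrite size_iota size_map leqNgt ltsq.
case/allPn=> i; rewrite mem_iota add0n => /andP[_ iq] it.
exists i => y ys; apply: contra it => qiy; apply/mapP; exists y => //.
move: qiy; rewrite -eqz_mod_dvd => /eqP <-.
by rewrite modz_small ?absz_nat.
Qed.

Lemma odd_exists_avoiding (n : nat) (s : seq int) : odd n -> (size s <= 4)%N ->
  ((3 %| n)%N -> exists c : int, forall y, y \in s -> ~~ (3 %| c - y)%Z) ->
  exists x : int, forall y, y \in s -> coprimez (x - y) n.
Proof.
move=> on s4 H3; apply: exists_avoiding; first exact: odd_gt0.
move=> q pq qn; have [e|q3] := eqVneq q 3%N; first by move: qn; rewrite e; apply: H3.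
apply: exists_nonresidue; apply: leq_ltn_trans s4 _.
have oq := dvdn_odd qn on.
by case: q pq qn oq q3 => [|[|[|[|[|]]]]].
Qed.

Section OddUnits.
Variables (G : zmodType) (n : nat) (A : int -> Prop) (h : int -> G).
Hypotheses (n_odd : odd n) (A_units : forall x, coprimez x n -> A x) (A0 : A 0)
  (h_add : forall x y, A x -> A y -> A (x + y) -> h (x + y) = h x + h y).

Let U x := coprimez x n.

Let h0 : h 0 = 0.
Proof. by have := h_add A0 A0; rewrite addr0 -{1}[h 0]addr0 => /(_ A0) /addrI. Qed.

Let U1 : U 1. Proof. by rewrite /U /coprimez gcd1z. Qed.
Let U2 : U 2. Proof. by rewrite /U coprimezE coprime2n. Qed.

Let UN x : U (- x) = U x. Proof. by rewrite /U coprimezE abszN -coprimezE. Qed.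

Let transfer1 x y x' y' : U x -> U y -> U x' -> U y' -> x + y = x' + y' ->
  U (x - x') -> h x + h y = h x' + h y'.
Proof.
move=> ux uy ux' uy' e ud.
have hx : h x = h x' + h (x - x') by rewrite -h_add ?subrKC //; apply: A_units.
have ey : y + (x - x') = y' by rewrite -[y'](addKr x') -e; ring.
have hy : h y' = h y + h (x - x') by rewrite -h_add ?ey //; apply: A_units.
by rewrite hx hy -addrA [_ + h y]addrC.
Qed.

Let U3 x : U x -> (3 %| n)%N -> ~~ (3 %| x)%Z.
Proof.
by move=> /(coprimezP _ (odd_gt0 n_odd)) ux n3; apply: (ux 3%N).
Qed.

(* The congruence x = x' mod 3 leaves room modulo 3 for a unit z such that
   both differences z - x and z - x' are units. *)
Let transfer2 x y x' y' : U x -> U y -> U x' -> U y' -> x + y = x' + y' ->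
  (3 %| x + y)%Z -> ((3 %| n)%N -> (3 %| x - x')%Z) -> h x + h y = h x' + h y'.
Proof.
move=> ux uy ux' uy' e m3 d3.
have [] := @odd_exists_avoiding n [:: 0; x; x'; x + y] n_odd isT.
  move=> n3; have {}d3 := d3 n3; have ux3 := U3 ux n3.
  have [x3|x3] := boolP (3 %| x)%Z; first exists 1 => z; last exists (- x) => z;
    rewrite !inE; lia.
move=> z Hz.
have uz : U z by rewrite -[z]subr0; apply: Hz; rewrite !inE eqxx.
have uzx : U (z - x) by apply: Hz; rewrite !inE eqxx ?orbT.
have uzx' : U (z - x') by apply: Hz; rewrite !inE eqxx ?orbT.
have uw : U (x + y - z) by rewrite -UN opprB; apply: Hz; rewrite !inE eqxx ?orbT.
have ez : z + (x + y - z) = x + y by rewrite addrC subrK.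
rewrite -(transfer1 uz uw ux uy) // (transfer1 uz uw ux' uy') //.
by rewrite ez.
Qed.

Let transfer x y x' y' : U x -> U y -> U x' -> U y' -> x + y = x' + y' ->
  (3 %| x + y)%Z -> h x + h y = h x' + h y'.
Proof.
move=> ux uy ux' uy' e m3.
have [n3|n3] := boolP (3 %| n)%N; last by apply: transfer2 => // ; rewrite (negPf n3).
have [d3|d3] := boolP (3 %| x - x')%Z; first exact: transfer2.
rewrite [RHS]addrC; apply: transfer2 => // [|_]; first by rewrite e addrC.
have := U3 ux n3; have := U3 ux' n3; move: e m3 d3; lia.
Qed.

Let sum3 (j : nat) : exists x y,
  [/\ U x, U y, x + y = 3 * j%:Z & h x + h y = h 1 *+ (3 * j)].
Proof.
elim: j => [|j [x [y [ux uy e IH]]]].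
  exists 1, (-1); rewrite UN mulr0 subrr muln0 mulr0n; split=> //.
  by rewrite -h_add ?subrr //; apply: A_units; rewrite ?UN.
have [] := @odd_exists_avoiding n [:: 0; -1; 3 * j%:Z; 3 * j%:Z + 2] n_odd isT.
  by move=> _; exists 1 => z; rewrite !inE; lia.
move=> z Hz.
have uz : U z by rewrite -[z]subr0; apply: Hz; rewrite !inE eqxx.
have uz1 : U (z + 1) by have := Hz (- 1); rewrite opprK; apply; rewrite !inE eqxx ?orbT.
have uw : U (3 * j%:Z - z) by rewrite -UN opprB; apply: Hz; rewrite !inE eqxx ?orbT.
have uw2 : U (3 * j%:Z - z + 2).
  by rewrite -UN (_ : - _ = z - (3 * j%:Z + 2)) ; [apply: Hz; rewrite !inE eqxx ?orbT|ring].
exists (z + 1), (3 * j%:Z - z + 2); split=> //; first by lia.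
have h2 : h 2 = h 1 + h 1 by rewrite -h_add //; apply: A_units.
have -> : h (z + 1) = h z + h 1 by apply: h_add; apply: A_units.
have -> : h (3 * j%:Z - z + 2) = h (3 * j%:Z - z) + h 2.
  exact: (h_add (A_units uw) (A_units U2) (A_units uw2)).
have -> : h z + h 1 + (h (3 * j%:Z - z) + h 2) = h z + h (3 * j%:Z - z) + h 1 *+ 3.
  by rewrite h2 addrACA [RHS]addrC [h 1 *+ 3]mulrS mulr2n addrC.
rewrite (transfer uz uw ux uy) ?IH ?e ?mulnS ?mulrnDr; try lia.
by rewrite addrC.
Qed.

Let hN x : U x -> h (- x) = - h x.
Proof.
move=> ux; apply/eqP; rewrite -addr_eq0 -h_add ?addNr ?h0 //; apply: A_units => //.
by rewrite -/(U _) UN.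
Qed.

Let sum_eq x y : U x -> U y -> (3 %| x + y)%Z -> h x + h y = h 1 *~ (x + y).
Proof.
have pos a b : U a -> U b -> (3 %| a + b)%Z -> 0 <= a + b ->
    h a + h b = h 1 *~ (a + b).
  move=> ua ub /dvdzP[j ej] j0.
  have [j' ej'] : exists j' : nat, j = j'%:Z by exists `|j|%N; lia.
  have [a' [b' [ua' ub' e IH]]] := sum3 j'.
  rewrite (transfer ua ub ua' ub') ?IH; rewrite ?ej ?ej' ?e //; try lia.
  by rewrite mulrC -[3 * _]/(Posz _).
move=> ux uy m3; have [/pos->//|m0] := leP 0 (x + y).
apply/eqP; rewrite -eqr_opp opprD -!hN // -mulrNz opprD pos ?UN //; lia.
Qed.

Let unit_eq x : U x -> h x = h 1 *~ x.
Proof.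
have h2 : h 2 = h 1 *~ 2 by rewrite [LHS](h_add (A_units U1) (A_units U1) (A_units U2)).
move=> ux; have [x0|x1|x2] : [\/ 3 %| x, 3 %| x + 1 | 3 %| x + 2]%Z.
- by apply/or3P; lia.
- have n3 : ~~ (3 %| n)%N by apply/negP => /(U3 ux); rewrite x0.
  have u3 : U 3 by rewrite /U coprimezE prime_coprime.
  have h3 : h 3 = h 1 *~ 3.
    transitivity (h 1 + h 2); first exact: (h_add (A_units U1) (A_units U2) (A_units u3)).
    by rewrite h2 -{1}[h 1]mulr1z -mulrzDr_tmp.
  have := sum_eq ux u3; rewrite h3 mulrzDr_tmp => H; apply: (addIr (h 1 *~ 3)).
  by apply: H; lia.
- by have := sum_eq ux U1 x1; rewrite mulrzDr_tmp => /addIr.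
- by have := sum_eq ux U2 x2; rewrite h2 mulrzDr_tmp => /addIr.
Qed.

Lemma odd_units_linear a : A a -> h a = h 1 *~ a.
Proof.
move=> Aa; have [] := @odd_exists_avoiding n [:: 0; a] n_odd isT.
  move=> _; have [a3|a3] := boolP (3 %| a)%Z; first exists 1 => z; last exists (- a) => z;
    rewrite !inE; lia.
move=> z Hz.
have uz : U z by rewrite -[z]subr0; apply: Hz; rewrite !inE eqxx.
have uw : U (a - z) by rewrite -UN opprB; apply: Hz; rewrite !inE eqxx ?orbT.
have e : z + (a - z) = a by rewrite addrC subrK.
rewrite -{1}e (h_add (A_units uz) (A_units uw)); last by rewrite e.
by rewrite (unit_eq uz) (unit_eq uw) -mulrzDr_tmp e.
Qed.

End OddUnits.

Lemma int_poly_root_conjugate (F : numFieldType) (P : {poly int}) (m : nat) (z w : F) :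
  m.-primitive_root z -> m.-primitive_root w ->
  root (map_poly intr P) z -> root (map_poly intr P) w.
Proof.
move=> pz pw Pz; have m0 := prim_order_gt0 pz.
have [t pt] := C_prim_root_exists m0.
pose Phi : {poly rat} := map_poly intr 'Phi_m.
pose Q : {poly rat} := map_poly intr P.
have rootPhi (K : numFieldType) (u : K) : m.-primitive_root u ->
    root (map_poly ratr Phi) u.
  move=> pu.
  have -> : map_poly ratr Phi = map_poly intr 'Phi_m :> {poly K}.
    by rewrite -map_poly_comp; apply: eq_map_poly => x /=; rewrite ratr_int.
  have mapC (d : nat) : (0 < d)%N ->
      'X^d - 1 = \prod_(e <- divisors d) map_poly intr 'Phi_e :> {poly K}.
    move=> d0; rewrite -rmorph_prod prod_Cyclotomic // rmorphB /= map_polyXn.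
    by rewrite rmorph1.
  have : root (\prod_(e <- divisors m) map_poly intr 'Phi_e) u.
    by rewrite -mapC // rootE !hornerE (prim_expr_order pu) subrr.
  rewrite rootE horner_prod prodf_seq_eq0 => /hasP[d dm /= ud].
  have d0 : (0 < d)%N by move: dm; rewrite -dvdn_divisors // => /dvdn_gt0; apply.
  have : root (\prod_(e <- divisors d) map_poly intr 'Phi_e) u.
    rewrite rootE horner_prod prodf_seq_eq0; apply/hasP; exists d => //; exact: divisors_id.
  rewrite -mapC // rootE !hornerE subr_eq0 -(prim_order_dvd pu).
  move: dm ud; rewrite -dvdn_divisors // => dm ud md.
  by have /eqP <- : d == m by rewrite eqn_dvd dm md.
have mapQ (K : numFieldType) : map_poly ratr Q = map_poly intr P :> {poly K}.
  by rewrite -map_poly_comp; apply: eq_map_poly => x /=; rewrite ratr_int.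
suff /dvdpP[r rE] : Phi %| Q.
  by rewrite -mapQ rE rmorphM rootM (rootPhi _ _ pw) orbT.
have [p [pE _ Hp]] := minCpolyP t.
have pPhi : p = Phi.
  apply: (map_poly_inj (ratr : {rmorphism rat -> algC})).
  rewrite -pE (minCpoly_cyclotomic pt) -(Cintr_Cyclotomic pt) -map_poly_comp.
  by apply: eq_map_poly => x /=; rewrite ratr_int.
rewrite {}pPhi in Hp.
pose g := gcdp Phi Q.
have gPhi : g %| Phi := dvdp_gcdl _ _.
have Phi0 : Phi != 0.
  by apply: monic_neq0; apply: monic_map (Cyclotomic_monic m).
have [k kE] := dvdpP _ _ gPhi.
have : root (map_poly ratr Phi) t by apply: rootPhi.
rewrite kE rmorphM rootM !Hp => /orP[Phik|Phig]; last first.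
  by rewrite -kE; apply: (dvdp_trans Phig); apply: dvdp_gcdr.
exfalso.
have g1 : (1 < size g)%N.
  rewrite ltn_neqAle eq_sym size_poly_gt0 gcdp_eq0 (negPf Phi0) andbT.
  apply/negP => cop.
  have := coprimep_root (p := map_poly ratr Phi) (q := map_poly ratr Q) (x := z).
  by rewrite coprimep_map => /(_ cop (rootPhi _ _ pz)); rewrite mapQ -rootE Pz.
have k0 : k != 0 by apply: contra_neq Phi0 => k0; rewrite kE k0 mul0r.
have g0 : g != 0 by rewrite -size_poly_gt0 ltnW.
have := dvdp_leq k0 Phik.
rewrite kE size_mul // -ltnS prednK ?addn_gt0 ?size_poly_gt0 ?k0 //.
by rewrite -[(size k).+1]addn1 leq_add2l leqNgt g1.
Qed.

Local Open Scope complex_scope.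
Local Open Scope quotient_scope.

Section Circle.
Variable R : realType.
Implicit Types (x y t : R) (m : int).

Lemma mod1D x y : mod1 (x + y) = mod1 x + mod1 y.
Proof. exact: Quotient.pi_add. Qed.

Lemma mod1_eq x y : (mod1 x == mod1 y) = (x - y \is a Num.int).
Proof. by rewrite /mod1 -Quotient.idealrBE. Qed.

Lemma mod1_0 : mod1 (0 : R) = 0.
Proof. by apply: (addrI (mod1 0)); rewrite -mod1D !addr0. Qed.

Lemma mod1N x : mod1 (- x) = - mod1 x.
Proof. by apply: (addrI (mod1 x)); rewrite -mod1D !subrr mod1_0. Qed.

Lemma mod1_eq0 x : (mod1 x == 0) = (x \is a Num.int).
Proof. by rewrite -mod1_0 mod1_eq subr0. Qed.

Lemma mod1_surj (c : circle R) : exists x, c = mod1 x.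
Proof. by exists (repr c); rewrite /mod1 reprK. Qed.

Lemma mod1_mulrz x m : mod1 (x *~ m) = mod1 x *~ m.
Proof.
have nat k : mod1 (x *+ k) = mod1 x *+ k.
  by elim: k => [|k IH]; rewrite ?mod1_0 // !mulrS mod1D IH.
by case: m => k; [exact: nat | rewrite NegzE !mulrNz mod1N nat].
Qed.

Lemma expiD x y : expi (x + y) = expi x * expi y.
Proof.
by rewrite /expi cosD sinD; simpc; congr (_ +i* _); rewrite addrC.
Qed.

Definition turn t : R[i] := expi (2 * pi * t).

Lemma turnD x y : turn (x + y) = turn x * turn y.
Proof. by rewrite /turn mulrDr expiD. Qed.

Lemma turn0 : turn 0 = 1.
Proof. by rewrite /turn mulr0 /expi cos0 sin0. Qed.

Lemma turnN x : turn (- x) = (turn x)^*.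
Proof. by rewrite /turn mulrN /expi cosN sinN. Qed.

Lemma turn_neq0 x : turn x != 0.
Proof.
have : turn x * turn (- x) = 1 by rewrite -turnD subrr turn0.
by apply: contra_eq_neq => ->; rewrite mul0r eq_sym oner_eq0.
Qed.

Lemma turnV x : turn (- x) = (turn x)^-1.
Proof.
by apply: (mulfI (turn_neq0 x)); rewrite -turnD subrr turn0 divff // turn_neq0.
Qed.

Lemma turnMn x k : turn (x *+ k) = turn x ^+ k.
Proof.
by elim: k => [|k IH]; rewrite ?turn0 // mulrS exprS turnD IH.
Qed.

Lemma turn1 : turn 1 = 1.
Proof. by rewrite /turn mulr1 /expi mulr_natl cos2pi sin2pi. Qed.

Lemma turn_int x : x \is a Num.int -> turn x = 1.
Proof.
have nat k : turn k%:R = 1 by rewrite turnMn turn1 expr1n.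
case/intrP => [[k|k] ->]; first exact: nat.
by rewrite NegzE mulrNz turnN nat rmorph1.
Qed.

Lemma turn_eq1 x : (turn x == 1) = (x \is a Num.int).
Proof.
apply/idP/idP => [|/turn_int -> //].
pose y := x - (Num.floor x)%:~R.
have xE : x = y + (Num.floor x)%:~R by rewrite subrK.
have /andP[y0 y1] : 0 <= y < 1.
  by rewrite subr_ge0 ltrBlDl -[X in _ + X]/(1%:~R) -intrD floor_itv.
rewrite xE turnD (turn_int (intr_int _ _)) mulr1 eq_complex /= => /andP[/eqP cos1 _].
suff -> : y = 0 by rewrite add0r intr_int.
have: sin (pi * y) ^+ 2 = 0.
  have := cos2Dsin2 (pi * y); move: cos1.
  rewrite -mulrA mulr_natl mulr2n cosD -!expr2. lra.
move/eqP; rewrite sqrf_eq0; apply: contraTeq => ny.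
have yp : 0 < y by rewrite lt_def ny.
apply: lt0r_neq0; apply: sin_gt0_pi.
by rewrite mulr_gt0 ?pi_gt0 // gtr_pMr ?pi_gt0.
Qed.

Lemma turn_eq x y : (turn x == turn y) = (mod1 x == mod1 y).
Proof.
rewrite mod1_eq -turn_eq1 turnD turnV -subr_eq0 -[RHS]subr_eq0.
rewrite -(mulfV (turn_neq0 y)) -mulrBl mulf_eq0 invr_eq0 (negPf (turn_neq0 y)).
by rewrite orbF.
Qed.

Lemma turn_surj (z : R[i]) : z * z^* = 1 -> exists t, z = turn t.
Proof.
case: z => a b; simpc => -[ab _].
have {}ab : b ^+ 2 = 1 - a ^+ 2 by rewrite -ab; ring.
have a1 : -1 <= a <= 1.
  by have b2 := sqr_ge0 b; apply/andP; split; nra.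
have pi2 : 2 * pi != 0 :> R by rewrite mulf_neq0 ?pnatr_eq0 // gt_eqF ?pi_gt0.
have [b0|b0] := leP 0 b.
  exists (acos a / (2 * pi)).
  by rewrite /turn mulrC divfK // /expi acosK ?sin_acos // -ab sqrtr_sqr ger0_norm.
exists (- (acos a / (2 * pi))); rewrite turnN /turn mulrC divfK // /expi acosK //=.
by rewrite sin_acos // -ab sqrtr_sqr ltr0_norm // opprK.
Qed.

End Circle.


Section Fourier.
Variables (R : realType) (n : nat).
Hypothesis n_gt1 : (1 < n)%N.
Implicit Types (x y k : 'Z_n) (f g : 'Z_n -> R[i]).

Let n_neq0 : n%:R != 0 :> R. Proof. by rewrite pnatr_eq0 -lt0n ltnW. Qed.

Let n_neq0C : n%:R != 0 :> R[i]. Proof. by rewrite pnatr_eq0 -lt0n ltnW. Qed.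

Lemma turn_modn m : turn ((m %% n)%N%:R / n%:R) = turn (m%:R / n%:R) :> R[i].
Proof.
rewrite {2}(divn_eq m n) natrD natrM mulrDl mulfK // turnD.
by rewrite [turn (_ %/ _)%:R]turn_int ?mul1r // pmulrn intr_int.
Qed.

Definition chr x : R[i] := turn (x%:R / n%:R).

Lemma val_ZnD x y : val (x + y) = ((x + y) %% n)%N.
Proof. by congr (_ %% _)%N; apply: Zp_cast. Qed.

Lemma val_ZnM x y : val (x * y) = ((x * y) %% n)%N.
Proof. by congr (_ %% _)%N; apply: Zp_cast. Qed.

Lemma ltn_Zn x : (x < n)%N.
Proof. by apply: leq_trans (ltn_ord x) _; rewrite Zp_cast. Qed.

Lemma chrD x y : chr (x + y) = chr x * chr y.
Proof. by rewrite /chr val_ZnD turn_modn natrD mulrDl turnD. Qed.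

Lemma chr0 : chr 0 = 1.
Proof. by rewrite /chr mul0r turn0. Qed.

Lemma chrN x : chr (- x) = (chr x)^*.
Proof.
have /mulfI : chr x != 0 by rewrite turn_neq0.
by apply; rewrite -chrD subrr chr0 /chr -turnN -turnD subrr turn0.
Qed.

Lemma chrM x y : chr (x * y) = turn (x%:R * y%:R / n%:R).
Proof. by rewrite /chr val_ZnM turn_modn natrM. Qed.

Lemma chr_neq0 x : chr x != 0. Proof. exact: turn_neq0. Qed.

Lemma chr_eq1 x : (chr x == 1) = (x == 0).
Proof.
apply/idP/eqP => [|->]; last by rewrite chr0.
rewrite turn_eq1 => /intrP[m e]; apply/val_inj => /=.
have : x%:R = m%:~R * n%:R :> R by rewrite -e divfK.
rewrite [x%:R]pmulrn [n%:R]pmulrn -intrM => /intr_inj.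
have xn := ltn_Zn x; move=> e2; change (nat_of_ord x = 0%N).
case: (ltgtP m 0) => m0; move: xn e2 m0; [nia | nia | ].
by move=> _ e2 m0; move: e2; rewrite m0 mul0r => -[].
Qed.

Lemma fourierE f k : fourier f k = \sum_j f j * chr (- (j * k)).
Proof.
apply: eq_bigr => j _; rewrite chrN chrM -turnN; congr (_ * expi _).
by rewrite mulrN !mulrA.
Qed.

Lemma sum_chr x : \sum_k chr (k * x) = if x == 0 then n%:R else 0.
Proof.
case: eqP => [->|/eqP x0].
  under eq_bigr do rewrite mulr0 chr0.
  by rewrite sumr_const card_ord Zp_cast.
have : chr x * \sum_k chr (k * x) = \sum_k chr (k * x).
  rewrite mulr_sumr [RHS](reindex_inj (addrI 1)).
  by apply: eq_bigr => k _; rewrite mulrDl mul1r chrD.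
set S := \sum_k _ => /eqP; rewrite -subr_eq0 -{2}[S]mul1r -mulrBl mulf_eq0.
by rewrite subr_eq0 chr_eq1 (negPf x0) => /eqP.
Qed.

Lemma fourier_inversion f x : \sum_k fourier f k * chr (k * x) = n%:R * f x.
Proof.
under eq_bigr => k _ do rewrite fourierE mulr_suml.
rewrite exchange_big /=.
transitivity (\sum_j f j * (if j == x then n%:R else 0)).
  apply: eq_bigr => j _; rewrite -[j == x]eq_sym -subr_eq0 -sum_chr mulr_sumr.
  apply: eq_bigr => k _; rewrite -mulrA -chrD; congr (_ * chr _).
  by rewrite mulrBr addrC [j * k]mulrC.
rewrite (bigD1 x) //= eqxx big1 ?addr0 1?mulrC // => j /negPf ->.
by rewrite mulr0.
Qed.

Lemma fourier_inj f g : fourier f =1 fourier g -> f =1 g.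
Proof.
move=> e x; apply: (mulfI n_neq0C); rewrite -!fourier_inversion.
by apply: eq_bigr => k _; rewrite e.
Qed.

Lemma fourier_shift f a k : fourier (fun x => f (x + a)) k = chr (a * k) * fourier f k.
Proof.
rewrite !fourierE (reindex_inj (addIr (- a))) mulr_sumr; apply: eq_bigr => x _ /=.
by rewrite subrK mulrBl opprB chrD mulrCA.
Qed.

Lemma fourierB f g k : fourier (fun x => f x - g x) k = fourier f k - fourier g k.
Proof.
by rewrite /fourier -sumrB; apply: eq_bigr => x _; rewrite mulrBl.
Qed.

Lemma fourier_real (f : 'Z_n -> R) k :
  fourier (fun x => (f x)%:C) (- k) = (fourier (fun x => (f x)%:C) k)^*.
Proof.
rewrite !fourierE rmorph_sum; apply: eq_bigr => x _.
by rewrite rmorphM [X in _ = X * _]conjc_real mulrN [LHS]mulrC chrN mulrC.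
Qed.

Lemma fourier_real_inv (g : 'Z_n -> R[i]) :
  (forall k, g (- k) = (g k)^*) ->
  exists u : 'Z_n -> R, forall k, fourier (fun x => (u x)%:C) k = g k.
Proof.
move=> gN; pose v x := n%:R^-1 * \sum_k g k * chr (k * x).
have vr x : (complex.Re (v x))%:C = v x.
  have : (v x)^* = v x.
    rewrite /v rmorphM rmorphV ?unitfE // rmorph_nat rmorph_sum; congr (_ * _).
    rewrite (reindex_inj oppr_inj); apply: eq_bigr => k _.
    rewrite rmorphM; congr (_ * _); first by rewrite -[in RHS](opprK k) [RHS]gN.
    by rewrite mulNr -[in RHS](opprK (k * x)) [RHS]chrN.
  by case: (v x) => a b [] /= e; congr (_ +i* _); lra.
exists (fun x => complex.Re (v x)) => k; rewrite fourierE.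
transitivity (n%:R^-1 * \sum_j g j * (if k == j then n%:R else 0)).
  under eq_bigr => x _ do rewrite vr /v -mulrA mulr_suml.
  rewrite -mulr_sumr exchange_big /=; congr (_ * _); apply: eq_bigr => j _.
  rewrite eq_sym -subr_eq0 -sum_chr mulr_sumr; apply: eq_bigr => x _.
  by rewrite -mulrA -chrD mulrBr [j * x]mulrC.
rewrite (bigD1 k) //= eqxx big1 ?addr0 => [|j /negPf]; last first.
  by rewrite eq_sym => ->; rewrite mulr0.
by rewrite mulrCA mulVf ?mulr1.
Qed.

Definition triple f k1 k2 := fourier f k1 * fourier f k2 * fourier f (- (k1 + k2)).

Lemma triple_deck (f : 'Z_n -> R) k1 k2 :
  triple (fun x => (f x)%:C) k1 k2 =
  fourier (fun x1 => fourier (fun x2 => (deck3 f x1 x2)%:C) k2) k1.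
Proof.
rewrite fourierE /triple; set F := fourier _.
transitivity (\sum_x1 \sum_x (f x)%:C * (f (x1 + x))%:C *
    (chr (x * k2) * F k2) * chr (- (x1 * k1))).
  rewrite exchange_big /= /F [fourier _ (- _)]fourierE mulr_sumr.
  apply: eq_bigr => x _.
  transitivity ((f x)%:C * (chr (x * k2) * F k2) * (chr (x * k1) * F k1)).
    rewrite mulrN opprK mulrDr chrD /F; ring.
  rewrite /F -[chr (x * k1) * _](fourier_shift (fun x => (f x)%:C)).
  rewrite [fourier (fun _ => _) k1]fourierE mulr_sumr.
  by apply: eq_bigr => x1 _; ring.
apply: eq_bigr => x1 _; rewrite -mulr_suml; congr (_ * _).
rewrite fourierE.
under [RHS]eq_bigr => x2 _ do rewrite rmorph_sum mulr_suml.
rewrite exchange_big /=; apply: eq_bigr => x _.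
rewrite /F -(fourier_shift (fun x => (f x)%:C)) fourierE mulr_sumr.
apply: eq_bigr => x2 _; rewrite !rmorphM /= [x1 + x]addrC [x2 + x]addrC; ring.
Qed.

Lemma deck3_triple (f g : 'Z_n -> R) :
  (forall k1 k2, triple (fun x => (f x)%:C) k1 k2 = triple (fun x => (g x)%:C) k1 k2) ->
  forall x1 x2, deck3 f x1 x2 = deck3 g x1 x2.
Proof.
move=> e x1 x2; suff [] : (deck3 f x1 x2)%:C = (deck3 g x1 x2)%:C by [].
pose D (h : 'Z_n -> R) y1 y2 := (deck3 h y1 y2)%:C.
suff : D f x1 =1 D g x1 by apply.
apply: fourier_inj => k2.
suff : (fun y1 => fourier (D f y1) k2) =1 (fun y1 => fourier (D g y1) k2) by apply.
by apply: fourier_inj => k1; rewrite -!triple_deck.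
Qed.

End Fourier.

Lemma val_ZnN n (n_gt1 : (1 < n)%N) (x : 'Z_n) : x != 0 -> (x + (- x)%R)%N = n.
Proof.
move=> x0; have xn := ltn_Zn n_gt1 x.
have xp : (0 < x)%N by rewrite lt0n; apply: contra_neq x0 => x0; apply: val_inj.
have -> : nat_of_ord (- x) = ((n - x) %% n)%N by congr ((_ - _) %% _)%N; apply: Zp_cast.
by rewrite modn_small; lia.
Qed.

Section DeckExtendable.
Variables (R : realType) (n : nat).
Hypothesis n_gt1 : (1 < n)%N.
Variable E : {set 'Z_n}.
Implicit Types (x y k : 'Z_n).

Let n_neq0 : n%:R != 0 :> R. Proof. by rewrite pnatr_eq0 -lt0n ltnW. Qed.

Let f := fun x => (chi R E x)%:C.
Let F := fourier f.
Let A := fourier_supp f.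

Lemma mem_supp k : (k \in A) = (F k != 0).
Proof. by rewrite inE. Qed.

Lemma supp0 : (0 \in A) = (E != set0).
Proof.
rewrite mem_supp /F fourierE //.
under eq_bigr do rewrite mulr0 oppr0 chr0 // mulr1.
have -> : \sum_i f i = #|E|%:R.
  rewrite -sum1_card natr_sum [RHS]big_mkcond; apply: eq_bigr => i _.
  by rewrite /f /chi; case: (i \in E).
by rewrite pnatr_eq0 cards_eq0.
Qed.

Lemma suppN k : (- k \in A) = (k \in A).
Proof. by rewrite !mem_supp /F fourier_real // fmorph_eq0. Qed.

Lemma chrMz k (m : int) : chr R (k *~ m) = turn ((k%:R / n%:R) *~ m).
Proof.
have nat (j : nat) : chr R (k *+ j) = turn ((k%:R / n%:R) *+ j).
  by elim: j => [|j IH]; rewrite ?chr0 ?turn0 // !mulrS chrD // turnD IH.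
case: m => j; first exact: nat.
by rewrite NegzE !mulrNz chrN // turnN; congr (_^*); apply: nat.
Qed.

Lemma fourier_empty : E = set0 -> extendable R A.
Proof.
move=> E0 h _; exists 0 => k; rewrite mem_supp /F /fourier big1 ?eqxx // => j _.
by rewrite /f /chi E0 inE mul0r.
Qed.

Lemma additive_on0 (h : 'Z_n -> circle R) : 0 \in A -> additive_on A h -> h 0 = 0.
Proof.
by move=> A0 /(_ 0 0 A0 A0); rewrite addr0 -{1}[h 0]addr0 => /(_ A0) /addrI.
Qed.

Lemma additive_onN (h : 'Z_n -> circle R) k : 0 \in A -> additive_on A h ->
  k \in A -> h (- k) = - h k.
Proof.
move=> A0 hA kA; apply/eqP; rewrite -addr_eq0 addrC -hA ?suppN ?subrr //.
by rewrite additive_on0.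
Qed.

Lemma extendable_deck (g : 'Z_n -> R) : E != set0 -> extendable R A ->
  (forall x1 x2 : 'Z_n, deck3 (chi R E) x1 x2 = deck3 g x1 x2) ->
  exists t : 'Z_n, forall x : 'Z_n, g x = chi R E (x - t).
Proof.
move=> En0 ext decks.
pose G := fourier (fun x => (g x)%:C).
have tri k1 k2 : F k1 * F k2 * F (- (k1 + k2)) = G k1 * G k2 * G (- (k1 + k2)).
  transitivity (triple (fun x => (chi R E x)%:C) k1 k2); first by [].
  transitivity (triple (fun x => (g x)%:C) k1 k2); last by [].
  rewrite !triple_deck //; apply: eq_bigr => j _; congr (_ * _).
  by apply: eq_bigr => i _; rewrite decks.
have A0 : 0 \in A by rewrite supp0.
have F0 : F 0 != 0 by rewrite -mem_supp.
have FN k : F (- k) = (F k)^* by apply: fourier_real.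
have GN k : G (- k) = (G k)^* by apply: fourier_real.
have G0 : G 0 = F 0.
  have real (z : R[i]) : z = z^* -> exists a, z = a%:C.
    by case: z => a b [] e; exists a; congr (_ +i* _); lra.
  have [|a Fa] := real (F 0); first by rewrite -FN oppr0.
  have [|b Gb] := real (G 0); first by rewrite -GN oppr0.
  have := tri 0 0; rewrite addr0 oppr0 Fa Gb -!rmorphM => -[].
  move: F0; rewrite Fa => a0 ab; congr (_%:C).
  have a2 : 0 < a * a.
    by rewrite -expr2 exprn_even_gt0 //=; apply: contraNneq a0 => ->.
  have : (b - a) * (b * b + a * b + a * a) = 0.
    by transitivity (b * b * b - a * a * a); [ring | rewrite ab subrr].
  have p : 0 < b * b + a * b + a * a by have := sqr_ge0 (b + a / 2); nra.
  by move/eqP; rewrite mulf_eq0 (gt_eqF p) orbF subr_eq0 => /eqP.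
have norm k : F k * (F k)^* = G k * (G k)^*.
  by apply: (mulIf F0); have := tri k (- k); rewrite subrr oppr0 FN GN G0.
have ex k : exists t, G k = F k * turn t.
  have [Fk|Fk] := eqVneq (F k) 0.
    exists 0; have := norm k; rewrite Fk !mul0r => /esym/eqP.
    by rewrite mulf_eq0 conjc_eq0 orbb => /eqP.
  have [|t ht] := @turn_surj R (G k / F k).
    rewrite rmorphM /= fmorphV mulrACA -norm -invfM mulfV //.
    by rewrite mulf_neq0 ?conjc_eq0.
  by exists t; rewrite -ht mulrC divfK.
have [th thE] := fin_all_exists ex.
have hadd : additive_on A (fun k => mod1 (th k)).
  move=> x y; rewrite !mem_supp => xA yA xyA.
  apply/eqP; rewrite -mod1D -turn_eq turnD; apply/eqP.
  have GE : G (- (x + y)) = (F (x + y))^* * (turn (th (x + y)))^-1.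
    by rewrite GN thE -turnV turnN rmorphM.
  have := tri x y; rewrite FN GE !thE => e.
  apply: (mulfI (x := F x * F y * (F (x + y))^*)).
    by rewrite !mulf_neq0 ?conjc_eq0.
  by rewrite {1}e; field; exact: turn_neq0.
have [L hL] := ext _ hadd.
suff [t ht] : exists t, forall k, k \in A -> turn (th k) = chr R (- t * k).
  exists t => x; suff : (fun x => (g x)%:C) =1 (fun x => f (x - t)) by move=> /(_ x) [].
  apply: (fourier_inj n_gt1) => k; rewrite fourier_shift // -/F -/G thE.
  have [kA|] := boolP (k \in A); first by rewrite ht // mulrC.
  by rewrite mem_supp negbK => /eqP ->; rewrite !mul0r mulr0.
have [/exists_inP[k kA k0]|/exists_inPn A1] := boolP [exists k in A, k != 0]; last first.
  exists 0 => k kA; have /eqP -> := negbNE (A1 k kA).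
  rewrite mulr0 chr0 //; apply/eqP; rewrite turn_eq1 -mod1_eq0; apply/eqP.
  exact: (additive_on0 A0 hadd).
have : mod1 (L * n%:R) == 0.
  rewrite -(val_ZnN n_gt1 k0) natrD mulrDr mod1D -!hL ?suppN //.
  by rewrite (additive_onN A0 hadd kA) subrr.
rewrite mod1_eq0 => /intrP[m mE].
exists (- m%:~R) => l lA; rewrite opprK mulrzl chrMz; apply/eqP; rewrite turn_eq.
by rewrite hL // -mulrzl -mE mulrA [L * _ * _]mulrAC mulfK.
Qed.

Lemma deck_extendable : E != set0 ->
  (forall g : 'Z_n -> R,
    (forall x1 x2 : 'Z_n, deck3 (chi R E) x1 x2 = deck3 g x1 x2) ->
    exists t : 'Z_n, forall x : 'Z_n, g x = chi R E (x - t)) ->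
  extendable R A.
Proof.
move=> En0 H h hadd.
have A0 : 0 \in A by rewrite supp0.
have [th thE] := fin_all_exists (fun k => mod1_surj (h k)).
have FN k : F (- k) = (F k)^* by apply: fourier_real.
have thN k : k \in A -> turn (th (- k)) = (turn (th k))^*.
  move=> kA; apply/eqP; rewrite -turnN turn_eq mod1N -!thE.
  by rewrite (additive_onN A0 hadd).
have conjM (a b : R[i]) : conjc (a * b) = conjc a * conjc b by rewrite rmorphM.
have c0 : conjc (0 : R[i]) = 0 by apply: rmorph0.
have [|g gE] := fourier_real_inv n_gt1 (g := fun k => F k * turn (th k)).
  move=> k. rewrite /= conjM. have [kA|] := boolP (k \in A); first by rewrite FN thN.
  by rewrite mem_supp negbK FN => /eqP ->; rewrite c0 !mul0r.
have [] := H g.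
  apply: (deck3_triple n_gt1) => k1 k2; rewrite /triple !gE -/F.
  have [k1A|] := boolP (k1 \in A); last first.
    by rewrite mem_supp negbK => /eqP ->; rewrite !mul0r.
  have [k2A|] := boolP (k2 \in A); last first.
    by rewrite mem_supp negbK => /eqP ->; rewrite !(mul0r, mulr0).
  have [k12A|] := boolP (k1 + k2 \in A); last first.
    by rewrite mem_supp negbK FN => /eqP ->; rewrite c0 !(mul0r, mulr0).
  have /eqP e : turn (th (k1 + k2)) == turn (th k1) * turn (th k2).
    by rewrite -turnD turn_eq mod1D -!thE hadd.
  by rewrite thN // -turnN turnV e; field; rewrite !turn_neq0.
move=> t gt; exists (- (t%:R / n%:R)) => k kA.
rewrite thE; apply/eqP; rewrite -turn_eq; apply/eqP.
have Fk : F k != 0 by rewrite -mem_supp.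
apply: (mulfI Fk); rewrite -gE.
have -> : fourier (fun x => (g x)%:C) k = fourier (fun x => f (x - t)) k.
  by apply: eq_bigr => x _; rewrite gt.
by rewrite fourier_shift // -/F mulrC mulNr chrN // chrM // -turnN mulNr mulrAC.
Qed.

End DeckExtendable.

Lemma prime_factorization (n : nat) : (0 < n)%N ->
  exists s : seq nat, all prime s /\ n = (\prod_(p <- s) p)%N.
Proof.
elim/ltn_ind: n => n IH n0; have [n1|n1] := leqP n 1.
  by exists [::]; rewrite big_nil; split=> //; lia.
have pd := pdiv_dvd n; have pp := pdiv_prime n1.
have [||s [sp sn]] := IH (n %/ pdiv n)%N.
- by rewrite ltn_Pdiv ?prime_gt1.
- by rewrite divn_gt0 ?prime_gt0 // dvdn_leq.
exists (pdiv n :: s); rewrite /= pp sp big_cons -sn; split=> //.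
by rewrite mulnC divnK.
Qed.

Lemma prod_prime_gt1 (s : seq nat) : all prime s -> s != [::] ->
  (1 < \prod_(p <- s) p)%N.
Proof.
elim: s => // p s IH /= /andP[pp ps] _; rewrite big_cons.
have [->|s0] := eqVneq s [::]; first by rewrite big_nil muln1 prime_gt1.
by have := IH ps s0; have := prime_gt1 pp; nia.
Qed.

Definition few_odd_primes (n : nat) :=
  (exists p k : nat, odd_prime p /\ n = (p ^ k)%N) \/
  (exists s : seq nat,
     [/\ (size s <= 3)%N, all odd_prime s & n = (\prod_(p <- s) p)%N]).

Lemma factor_cases (n : nat) : (3 <= n)%N ->
  [\/ few_odd_primes n, ~~ odd n
    | exists p q r s, [/\ n = (p * q * r * s)%N, coprime p q, (1 < p)%N, (1 < q)%N
                        & (1 < r)%N && (1 < s)%N]].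
Proof.
move=> n3; have [on|] := boolP (odd n); last by constructor 2.
have [s [sp sn]] := prime_factorization (ltnW (ltnW n3)).
have so : all odd_prime s.
  apply/allP => p ps; rewrite /odd_prime (allP sp) // andbT.
  by apply: dvdn_odd on; rewrite sn (big_rem p) //= dvdn_mulr.
have [s3|s3] := leqP (size s) 3; first by constructor 1; right; exists s.
case: s => [|p0 s] // in sp sn so s3 *.
have [/all_pred1P e|/allPn[q qs /= qp]] := boolP (all (pred1 p0) s).
  constructor 1; left; exists p0, (size s).+1; split; first by case/andP: so.
  by rewrite sn big_cons e big_nseq iter_muln_1 expnS size_nseq.
constructor 3; have /andP[pp sp'] := sp.
have : size (rem q s) = (size s).-1 by apply: size_rem.
case E : (rem q s) => [|r t] /= st; first by move: s3 st => /=; lia.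
have tp : all prime (r :: t).
  by rewrite -E; apply/allP => x /mem_rem; apply: (allP sp').
have /andP[rp tp'] := tp.
exists p0, q, r, (\prod_(x <- t) x)%N; split.
- by rewrite sn big_cons (big_rem q) //= E big_cons !mulnA.
- by rewrite (prime_coprime _ pp) (dvdn_prime2 pp) 1?eq_sym // (allP sp').
- exact: prime_gt1.
- by apply: prime_gt1; apply: (allP sp').
- rewrite prime_gt1 // prod_prime_gt1 //; apply/eqP => t0.
  by move: s3 st; rewrite t0 /=; lia.
Qed.

Section BlockSums.
Variable K : fieldType.

Lemma sum_blocks (a b : nat) (g : nat -> K) :
  \sum_(j < a * b) g j = \sum_(i < a) \sum_(l < b) g (i * b + l)%N.
Proof.
elim: a => [|a IH]; first by rewrite mul0n !big_ord0.
rewrite big_ord_recr /= -IH mulSnr big_split_ord /=; congr (_ + _).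
Qed.

Lemma sum_low_blocks (a b m : nat) (w : K) : (m <= b)%N ->
  \sum_(j < a * b) (j %% b < m)%N%:R * w ^+ j =
  (\sum_(i < a) (w ^+ b) ^+ i) * \sum_(l < m) w ^+ l.
Proof.
move=> mb; rewrite (sum_blocks a b (fun j => (j %% b < m)%N%:R * w ^+ j)).
rewrite mulr_suml; apply: eq_bigr => i _.
rewrite mulr_sumr (big_ord_widen b (fun l => (w ^+ b) ^+ i * w ^+ l)) // [RHS]big_mkcond.
apply: eq_bigr => l _; rewrite modnMDl modn_small //.
by case: ltnP => _; rewrite ?mul0r // mul1r exprD mulnC exprM.
Qed.

Lemma sum_multiples (r m : nat) (g : nat -> K) : (0 < r)%N ->
  \sum_(j < m * r) (r %| j)%N%:R * g j = \sum_(y < m) g (y * r)%N.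
Proof.
case: r => // r _; rewrite (sum_blocks m r.+1 (fun j => (r.+1 %| j)%N%:R * g j)).
apply: eq_bigr => i _; rewrite big_ord_recl /= addn0 dvdn_mull // mul1r.
rewrite big1 ?addr0 // => l _; rewrite dvdn_addr ?dvdn_mull //.
by rewrite gtnNdvd ?mul0r // /bump /= add1n ltnS.
Qed.

Lemma geom_sum0 (m : nat) (w : K) : w != 1 -> w ^+ m = 1 -> \sum_(i < m) w ^+ i = 0.
Proof.
move=> w1 wm; have := subrX1 w m; rewrite wm subrr => /esym/eqP.
by rewrite mulf_eq0 subr_eq0 (negPf w1) => /eqP.
Qed.

End BlockSums.

Section NotExtendable.
Variables (R : realType) (n : nat).
Hypothesis n_gt2 : (2 < n)%N.
Let n_gt1 : (1 < n)%N := ltnW n_gt2.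
Implicit Types (x y k : 'Z_n).

Let n_neq0 : n%:R != 0 :> R. Proof. by rewrite pnatr_eq0 -lt0n ltnW. Qed.

Local Notation F E := (fourier (fun x => (chi R E x)%:C)).
Local Notation A E := (fourier_supp (fun x => (chi R E x)%:C)).

Lemma val_Zn_nat m : nat_of_ord (m%:R : 'Z_n) = (m %% n)%N.
Proof. exact: val_Zp_nat. Qed.

Lemma Zn_mulrn_eq0 k m : (k *+ m == 0) = (n %| k * m)%N.
Proof.
rewrite -mulr_natr -val_eqE [val _]val_ZnM // val_Zn_nat modnMmr.
by rewrite /dvdn.
Qed.

Lemma chrN_expr_eq1 k m : (chr R (- k) ^+ m == 1) = (n %| k * m)%N.
Proof.
have -> : chr R (- k) ^+ m = chr R (- (k *+ m)).
  elim: m => [|m IH]; first by rewrite mulr0n oppr0 chr0.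
  by rewrite exprS IH -chrD // -opprD -mulrS.
by rewrite chr_eq1 // oppr_eq0 Zn_mulrn_eq0.
Qed.

Lemma fourier_indicator (P : pred nat) k :
  F [set x : 'Z_n | P x] k = \sum_(j < n) (P j)%:R * chr R (- k) ^+ j.
Proof.
rewrite fourierE //.
have e : (Zp_trunc n).+2 = n by exact: Zp_cast.
rewrite (reindex (cast_ord (esym e))) /=; last first.
  by exists (cast_ord e) => i _; apply: val_inj.
apply: eq_bigr => j _; congr (_ * _).
  by rewrite /chi inE /=; case: (P j).
have -> : cast_ord (esym e) j = j%:R :> 'Z_n.
  by apply: val_inj => /=; rewrite val_Zn_nat modn_small.
elim: (nat_of_ord j) => [|m IH]; first by rewrite mul0r oppr0 chr0.
by rewrite exprS -IH -chrD // -opprD [m.+1%:R]mulrS mulrDl mul1r.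
Qed.

Lemma even_not_extendable : ~~ odd n ->
  exists E : {set 'Z_n}, ~ extendable R (A E).
Proof.
move=> en; exists [set x : 'Z_n | (x < n./2)%N] => ext.
set B := A _ in ext.
have nE : n = (n./2 * 2)%N by rewrite muln2 even_halfK.
have FE k : F [set x : 'Z_n | (x < n./2)%N] k = \sum_(j < n./2) chr R (- k) ^+ j.
  rewrite (fourier_indicator (fun j => j < n./2)%N).
  rewrite (big_ord_widen n (fun j => chr R (- k) ^+ j)) /= ?[in RHS]big_mkcond; last lia.
  by apply: eq_bigr => j _; case: ifP; rewrite ?mul1r ?mul0r.
have Beven k : k \in B -> ~~ odd k -> k = 0.
  rewrite inE FE => kB ek; apply/eqP; apply: contraNT kB => k0.
  apply/eqP/geom_sum0; first by rewrite chr_eq1 // oppr_eq0.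
  apply/eqP; rewrite chrN_expr_eq1 [X in (X %| _)%N]nE [(k * _)%N]mulnC.
  rewrite dvdn_pmul2l; last lia.
  by rewrite dvdn2.
have B1 : 1 \in B.
  rewrite inE FE; apply/eqP => s0.
  have := subrX1 (chr R (- 1 : 'Z_n)) n./2; rewrite s0 mulr0 => /eqP.
  rewrite subr_eq0 chrN_expr_eq1 (val_Zn_nat 1) modn_small // mul1n.
  by apply/negP; rewrite gtnNdvd; lia.
have Bn0 : [set x : 'Z_n | (x < n./2)%N] != set0.
  by apply/set0Pn; exists 0; rewrite inE /=; lia.
have BN k : (- k \in B) = (k \in B) by apply: suppN.
pose a : R := (2 * n%:R)^-1.
pose h k : circle R := if k == 1 then mod1 a else if k == - 1 then - mod1 a else 0.
have neq1 : (1 : 'Z_n) != - 1.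
  rewrite -subr_eq0 opprK -[1 + 1]/(1 *+ 2) Zn_mulrn_eq0 (val_Zn_nat 1) modn_small //.
  by rewrite gtnNdvd.
have h0 : h 0 = 0.
  rewrite /h; case: eqP => [/esym/eqP|_]; first by rewrite oner_eq0.
  by case: eqP => // /esym/eqP; rewrite oppr_eq0 oner_eq0.
have hN k : h (- k) = - h k.
  rewrite /h eqr_opp eqr_oppLR; have [->|k1] := eqVneq k 1.
    by rewrite (negPf neq1).
  by have [_|_] := eqVneq k (- 1); rewrite ?opprK ?oppr0.
have hadd : additive_on B h.
  move=> x y xB yB xyB.
  have [x0|x0] := eqVneq x 0; first by rewrite x0 !add0r h0 add0r.
  have [y0|y0] := eqVneq y 0; first by rewrite y0 !addr0 h0 addr0.
  have ox : odd x by apply: contraNT x0 => /(Beven _ xB) ->.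
  have oy : odd y by apply: contraNT y0 => /(Beven _ yB) ->.
  have xy0 : x + y = 0.
    apply: Beven => //; rewrite [nat_of_ord _]val_ZnD // odd_mod ?(negPf en) //.
    by rewrite oddD ox oy.
  by rewrite xy0 h0 -(addrK x y) [y + x]addrC xy0 sub0r hN subrr.
have [L hL] := ext h hadd.
have : mod1 (L * n%:R) == 0.
  rewrite -(val_ZnN n_gt1 (oner_neq0 'Z_n)) natrD mulrDr mod1D -!hL ?BN //.
  by rewrite hN subrr.
have := hL 1 B1; rewrite /h eqxx (val_Zn_nat 1) modn_small // mulr1 => /eqP.
rewrite mod1_eq mod1_eq0 => aL Ln.
have : (a - L) * n%:R + L * n%:R \is a Num.int by rewrite rpredD // rpredM // natr_int.
have -> : (a - L) * n%:R + L * n%:R = 2^-1 by rewrite /a; field.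
case/intrP => m /(congr1 ( *%R 2)); rewrite mulfV ?pnatr_eq0 // => e.
have : 1 = 2 * m by apply: (@intr_inj R); rewrite intrM -e.
lia.
Qed.

Lemma four_factors_not_extendable (p q r s : nat) : n = (p * q * r * s)%N ->
  coprime p q -> (1 < p)%N -> (1 < q)%N -> (1 < r)%N -> (1 < s)%N ->
  exists E : {set 'Z_n}, ~ extendable R (A E).
Proof.
move=> nE cpq p1 q1 r1 s1.
(* Multiples of r see period prs, all other numbers period qrs; the latter sum
   is T minus its part U over the multiples of r. *)
pose P j := if (r %| j)%N then (j %% (p * r * s) < r * s)%N
            else (j %% (q * r * s) < r * s)%N.
exists [set x : 'Z_n | P x] => ext; set B := A _ in ext.
have [p0 q0 r0 s0] : [/\ 0 < p, 0 < q, 0 < r & 0 < s]%N by split; apply: ltnW.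
pose S1 (w : R[i]) :=
  (\sum_(i < q) ((w ^+ r) ^+ (p * s)) ^+ i) * \sum_(l < s) (w ^+ r) ^+ l.
pose U (w : R[i]) :=
  (\sum_(i < p) ((w ^+ r) ^+ (q * s)) ^+ i) * \sum_(l < s) (w ^+ r) ^+ l.
pose T (w : R[i]) :=
  (\sum_(i < p) (w ^+ (q * r * s)) ^+ i) * \sum_(l < r * s) w ^+ l.
have blocks (a b : nat) (w : R[i]) : n = (a * (b * s) * r)%N -> (0 < b)%N ->
    \sum_(j < n) (r %| j)%N%:R * ((j %% (b * r * s) < r * s)%N%:R * w ^+ j) =
    (\sum_(i < a) ((w ^+ r) ^+ (b * s)) ^+ i) * \sum_(l < s) (w ^+ r) ^+ l.
  move=> -> b0; rewrite -sum_low_blocks ?leq_pmull //.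
  rewrite (sum_multiples _ (fun j => (j %% (b * r * s) < r * s)%N%:R * w ^+ j)) //.
  apply: eq_bigr => y _; rewrite mulnAC -muln_modl [(r * s)%N]mulnC ltn_pmul2r //.
  by rewrite exprM exprAC.
have FE k : F [set x : 'Z_n | P x] k =
    let w := chr R (- k) in S1 w + T w - U w.
  rewrite fourier_indicator /=; set w := chr R _.
  have -> : S1 w = \sum_(j < n) (r %| j)%N%:R * ((j %% (p * r * s) < r * s)%N%:R * w ^+ j).
    by rewrite (blocks q p) // nE; ring.
  have -> : U w = \sum_(j < n) (r %| j)%N%:R * ((j %% (q * r * s) < r * s)%N%:R * w ^+ j).
    by rewrite (blocks p q) // nE; ring.
  have -> : T w = \sum_(j < n) (j %% (q * r * s) < r * s)%N%:R * w ^+ j.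
    rewrite /T -sum_low_blocks; last by rewrite -mulnA leq_pmull.
    by have -> : (p * (q * r * s))%N = n by rewrite nE; ring.
  rewrite -big_split -sumrB; apply: eq_bigr => j _; rewrite /P /=.
  by case: ifP => _; rewrite ?mul1r ?mul0r ?addrK ?add0r ?subr0.
have expr_dvd (m a : nat) k : n = (m * a)%N -> (chr R (- k) ^+ m == 1) = (a %| k)%N.
  move=> na; rewrite chrN_expr_eq1 {1}na mulnC dvdn_pmul2r //.
  by case: m na n_gt2 => // ->.
have wqrs k : (chr R (- k) ^+ (q * r * s) == 1) = (p %| k)%N.
  by apply: expr_dvd; rewrite nE; ring.
have wprs k : (chr R (- k) ^+ (p * r * s) == 1) = (q %| k)%N.
  by apply: expr_dvd; rewrite nE; ring.
have wrs k : (chr R (- k) ^+ (r * s) == 1) = (p * q %| k)%N.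
  by apply: expr_dvd; rewrite nE; ring.
have wr k : (chr R (- k) ^+ r == 1) = (p * q * s %| k)%N.
  by apply: expr_dvd; rewrite nE; ring.
have wn (k : 'Z_n) : chr R (- k) ^+ n = 1.
  by apply/eqP; rewrite chrN_expr_eq1 dvdn_mull.
have S10 (k : 'Z_n) : ~~ (q %| k)%N -> S1 (chr R (- k)) = 0.
  move=> qk; rewrite /S1 geom_sum0 ?mul0r //.
    by rewrite -exprM (_ : r * (p * s) = p * r * s)%N ?wprs //; ring.
  rewrite -!exprM -[RHS](wn k); congr (_ ^+ _); rewrite nE; ring.
have U0 (k : 'Z_n) : ~~ (p %| k)%N -> U (chr R (- k)) = 0.
  move=> pk; rewrite /U geom_sum0 ?mul0r //.
    by rewrite -exprM (_ : r * (q * s) = q * r * s)%N ?wqrs //; ring.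
  rewrite -!exprM -[RHS](wn k); congr (_ ^+ _); rewrite nE; ring.
have T0 (k : 'Z_n) : ~~ (p %| k)%N -> T (chr R (- k)) = 0.
  move=> pk; rewrite /T geom_sum0 ?mul0r ?wqrs //.
  rewrite -!exprM -[RHS](wn k); congr (_ ^+ _); rewrite nE; ring.
have Bdvd k : k \in B -> (p %| k)%N || (q %| k)%N.
  rewrite inE FE /=; apply: contraNT; rewrite negb_or => /andP[pk qk].
  by rewrite S10 // T0 // U0 // subr0 addr0.
have Bpq k : k \in B -> (p * q %| k)%N -> (p * q * s %| k)%N.
  rewrite inE FE /= => kB pqk; apply: contraNT kB; rewrite -wr => wr1.
  have wrs1 : (chr R (- k) ^+ r) ^+ s = 1 by rewrite -exprM; apply/eqP; rewrite wrs.
  have g0 := geom_sum0 wr1 wrs1.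
  rewrite /S1 /U /T g0 !mulr0 subr0 add0r.
  rewrite [\sum_(l < r * s) _]geom_sum0 ?mulr0 //; last by rewrite exprM.
  by apply: contraNneq wr1 => ->; rewrite expr1n.
have ltn_n d m : (1 < m)%N -> n = (d * m)%N -> (d < n)%N.
  by move=> m1 e; have := n_gt2; rewrite e; nia.
have qn : (q < n)%N by apply: (@ltn_n q (p * r * s)%N); [nia | rewrite nE; ring].
have pn : (p < n)%N by apply: (@ltn_n p (q * r * s)%N); [nia | rewrite nE; ring].
have vq : nat_of_ord (q%:R : 'Z_n) = q by rewrite val_Zn_nat modn_small.
have vp : nat_of_ord (p%:R : 'Z_n) = p by rewrite val_Zn_nat modn_small.
have npq : ~~ (p %| q)%N.
  by apply/negP => pq; move: cpq; rewrite /coprime (gcdn_idPl pq); lia.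
have nqp : ~~ (q %| p)%N.
  by apply/negP => qp; move: cpq; rewrite /coprime (gcdn_idPr qp); lia.
have geom (K : fieldType) (w : K) m : w ^+ m != 1 -> \sum_(i < m) w ^+ i != 0.
  move=> wm; apply/eqP => g0; have := subrX1 w m.
  by rewrite g0 mulr0 => /eqP; rewrite subr_eq0 (negPf wm).
have Bq : (q%:R : 'Z_n) \in B.
  rewrite inE FE /= T0 ?U0 ?vq // subr0 addr0 mulf_neq0 //.
    rewrite (eq_bigr (fun=> 1)) ?sumr_const ?card_ord ?pnatr_eq0 -?lt0n // => i _.
    rewrite -(exprM _ r) (_ : r * (p * s) = p * r * s)%N; last by ring.
    have q1' : chr R (- (q%:R : 'Z_n)) ^+ (p * r * s) = 1 by apply/eqP; rewrite wprs vq.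
    by rewrite q1' expr1n.
  apply: geom; rewrite -exprM wrs vq gtnNdvd // -{1}[q]mul1n ltn_pmul2r //.
have Bp : (p%:R : 'Z_n) \in B.
  rewrite inE FE /= S10 ?vp // add0r /T /U.
  set w := chr R _.
  have e1 (i : nat) : (w ^+ (q * r * s)) ^+ i = 1.
    have p1' : w ^+ (q * r * s) = 1 by apply/eqP; rewrite wqrs vp.
    by rewrite p1' expr1n.
  have e2 : (w ^+ r) ^+ (q * s) = w ^+ (q * r * s).
    by rewrite -exprM; congr (_ ^+ _); ring.
  rewrite e2; have -> : \sum_(i < p) (w ^+ (q * r * s)) ^+ i = p%:R.
    by under eq_bigr do rewrite e1; rewrite sumr_const card_ord.
  rewrite -mulrBr mulf_neq0 ?pnatr_eq0 -?lt0n //.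
  have wrs1 : w ^+ (r * s) != 1.
    by rewrite wrs vp gtnNdvd // -{1}[p]muln1 ltn_pmul2l.
  rewrite subr_eq0; apply/eqP => g.
  have h1 := subrX1 w (r * s); have h2 := subrX1 (w ^+ r) s.
  have : w ^+ r.-1 == 1.
    have g0 := geom _ _ _ wrs1.
    have w0 : w != 0 by apply: chr_neq0.
    have : (w ^+ r - 1) * \sum_(l < r * s) w ^+ l = (w - 1) * \sum_(l < r * s) w ^+ l.
      by rewrite {1}g -h2 -h1 exprM.
    move/(mulIf g0)/addIr => e; apply/eqP; apply: (mulfI w0).
    by rewrite -exprS prednK // mulr1.
  rewrite chrN_expr_eq1 vp {1}nE -!mulnA dvdn_pmul2l // => /dvdn_leq dv.
  have rqrs : (r <= q * (r * s))%N by rewrite mulnCA leq_pmulr // muln_gt0 q0.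
  have r1' : (0 < r.-1)%N by lia.
  by have := dv r1'; lia.
pose d : R := (p * q * s)%:R.
have d0 : d != 0 by rewrite pnatr_eq0; nia.
have nd : n%:R / d = r%:R.
  by rewrite /d nE !natrM; field; rewrite !pnatr_eq0 -!lt0n p0 q0 s0.
pose h k : circle R := if (q %| k)%N then mod1 (k%:R / d) else 0.
have modh m : mod1 ((m %% n)%N%:R / d) = mod1 (m%:R / d).
  apply/eqP; rewrite mod1_eq {2}(divn_eq m n) natrD natrM mulrDl opprD addrA addrAC.
  by rewrite subrr add0r rpredN -mulrA nd rpredM ?natr_int.
have qdn : (q %| n)%N by rewrite nE -!mulnA dvdn_mull // dvdn_mulr.
have pdn : (p %| n)%N by rewrite nE -!mulnA dvdn_mulr.
have dvdD t x y : (t %| n)%N -> (t %| (x + y)%R)%N = (t %| (x : nat) + y)%N.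
  by move=> tn; rewrite [nat_of_ord (x + y)]val_ZnD // /dvdn modn_dvdm.
have h0 m : (p * q * s %| m)%N -> mod1 (m%:R / d) = 0.
  case/dvdnP => j ->; apply/eqP; rewrite mod1_eq0 natrM -/d mulfK // natr_int.
have hpq k : k \in B -> (p %| k)%N -> h k = 0.
  rewrite /h => kB pk; case: ifP => // qk; apply: h0; apply: Bpq => //.
  by rewrite Gauss_dvd // pk.
have hadd : additive_on B h.
  move=> x y xB yB xyB.
  have hD : (q %| x)%N -> (q %| y)%N -> h (x + y) = h x + h y.
    move=> qx qy; rewrite /h dvdD // dvdn_addr // qx qy.
    by rewrite -mod1D -mulrDl -natrD [nat_of_ord (x + y)]val_ZnD // modh.
  have [/andP[qx qy]|nq] := boolP ((q %| x)%N && (q %| y)%N); first exact: hD.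
  have [/andP[px py]|np] := boolP ((p %| x)%N && (p %| y)%N).
    by rewrite !hpq ?addr0 // dvdD // dvdn_add.
  have := Bdvd _ xyB; rewrite !dvdD //.
  have [px|px] := boolP (p %| x)%N.
    rewrite px /= in np; rewrite (dvdn_addr _ px) (negPf np) /=.
    have qy := Bdvd _ yB; rewrite (negPf np) /= in qy.
    by rewrite (dvdn_addl _ qy) => qx; rewrite qx qy in nq.
  have qx := Bdvd _ xB; rewrite (negPf px) /= in qx.
  rewrite qx /= in nq; rewrite (dvdn_addr _ qx) (negPf nq) orbF.
  have py := Bdvd _ yB; rewrite (negPf nq) orbF in py.
  by rewrite (dvdn_addl _ py) (negPf px).
have [L hL] := ext h hadd.
have := hL _ Bq; rewrite /h vq dvdnn => /eqP; rewrite mod1_eq => hq.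
have := hL _ Bp; rewrite /h vp (negPf nqp) => /esym/eqP; rewrite mod1_eq0 => hp.
have : (q%:R / d - L * q%:R) * p%:R + (L * p%:R) * q%:R \is a Num.int.
  by rewrite rpredD // rpredM // natr_int.
have -> : (q%:R / d - L * q%:R) * p%:R + (L * p%:R) * q%:R = s%:R^-1.
  by rewrite /d !natrM; field; rewrite !pnatr_eq0 -!lt0n p0 q0 s0.
case/intrP => m /(congr1 ( *%R s%:R)); rewrite mulfV ?pnatr_eq0 -?lt0n // => e.
have : 1 = s%:Z * m by apply: (@intr_inj R); rewrite intrM -e.
by have [m0|m0] := leP m 0; nia.
Qed.

End NotExtendable.

Lemma chinese_pair (a b : nat) (x y : int) : (gcdn a b %| x - y)%Z ->
  exists z : int, (a %| z - x)%Z /\ (b %| z - y)%Z.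
Proof.
have [u [v uv]] := Bezoutz a b.
have -> : Posz (gcdn a b) = gcdz a b by [].
case/dvdzP => t xy; exists (x - u * a * t); split.
  have -> : x - u * a * t - x = - (u * t) * a by ring.
  exact: dvdz_mull.
have -> : x - u * a%:Z * t - y = t * v * b.
  have -> : x - u * a%:Z * t - y = (x - y) - u * a * t by ring.
  by rewrite xy -uv; ring.
exact: dvdz_mull.
Qed.

Lemma chinese_compatible (s : seq nat) (m : nat -> nat) (c : nat -> int) :
  {in s &, forall i j, (gcdn (m i) (m j) %| c i - c j)%Z} ->
  exists x : int, {in s, forall i, (m i %| x - c i)%Z}.
Proof.
elim: s => [|i s IH] H; first by exists 0.
have [|x Hx] := IH; first by move=> j k js ks; apply: H; rewrite inE ?js ?ks orbT.
pose M := (\big[lcmn/1]_(j <- s) m j)%N.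
have mM j : j \in s -> (m j %| M)%N.
  rewrite /M; elim: s {IH H Hx M} => // k s IHs; rewrite inE big_cons.
  by case/orP => [/eqP->|/IHs h]; rewrite ?dvdn_lcml // (dvdn_trans h) ?dvdn_lcmr.
have [|z [zM zi]] := @chinese_pair M (m i) x (c i).
  have : {in s, forall j, (gcdn (m j) (m i) %| x - c i)%Z}.
    move=> j js; rewrite -(subrKA (c j)) rpredD //.
      by apply: dvdz_trans (Hx j js); rewrite dvdzE !absz_nat dvdn_gcdl.
    by apply: H; rewrite !inE ?js ?eqxx ?orbT.
  rewrite /M; elim: s {IH H Hx M mM} => [|k s IHs] h.
    by rewrite big_nil gcd1n dvd1z.
  rewrite big_cons Order.NatDvd.meetUl dvdzE absz_nat dvdn_lcm.
  have := h k (mem_head _ _); rewrite dvdzE absz_nat => -> /=.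
  have h' : {in s, forall j, (gcdn (m j) (m i) %| x - c i)%Z}.
    by move=> j js; apply: h; rewrite inE js orbT.
  by have := IHs h'; rewrite dvdzE absz_nat.
exists z => j; rewrite inE => /orP[/eqP->//|js].
rewrite -(subrKA x) rpredD ?Hx //; apply: dvdz_trans zM.
by rewrite dvdzE !absz_nat mM.
Qed.

Lemma leq_size_factorization (s t : seq nat) : all prime s -> all (leq 2) t ->
  (\prod_(p <- s) p = \prod_(x <- t) x)%N -> (size t <= size s)%N.
Proof.
have [m] := ubnP (\prod_(p <- s) p); elim: m s t => // m IH [|p s] t.
  move=> _ _ ; case: t => // x t /= /andP[x2 t2]; rewrite big_nil big_cons.
  move=> e; have : (x %| 1)%N by rewrite e dvdn_mulr.
  by rewrite dvdn1 => /eqP x1; rewrite x1 in x2.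
rewrite big_cons /= => ltm /andP[pp ps] t2 e.
have ps0 : (0 < \prod_(q <- s) q)%N.
  by rewrite big_seq prodn_cond_gt0 // => q /(allP ps) /prime_gt0.
have : (p %| \prod_(x <- t) x)%N by rewrite -e dvdn_mulr.
rewrite Euclid_dvd_prod // big_has => /hasP[x xt px].
have pt := perm_to_rem xt.
have et : (\prod_(y <- t) y = x * \prod_(y <- rem x t) y)%N by rewrite (big_rem x).
have rt2 : all (leq 2) (rem x t) by apply/allP => y /mem_rem; apply: (allP t2).
have st : size t = (size (rem x t)).+1.
  by rewrite (size_rem xt) prednK //; case: (t) xt.
have [u xE] := dvdnP px.
have lt : (\prod_(q <- s) q < m)%N.
  by have := prime_gt1 pp; nia.
have [u1|u1] := leqP u 1.
  have {}xE : x = p.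
    have := allP t2 x xt; have := prime_gt1 pp; rewrite xE.
    case: u u1 xE => [|[|]] //= _ _; lia.
  rewrite st ltnS; apply: IH => //.
  apply/eqP; rewrite -(eqn_pmul2l (prime_gt0 pp)) e et xE; exact: eqxx.
rewrite st; apply: leqW; apply: (IH s (u :: rem x t)) => //=; first by rewrite u1.
by apply/eqP; rewrite -(eqn_pmul2l (prime_gt0 pp)) e et big_cons xE mulnA [(p * u)%N]mulnC.
Qed.

Lemma three_factors_prime (s : seq nat) (a b c : nat) : all prime s ->
  (size s <= 3)%N -> (\prod_(p <- s) p = a * b * c)%N ->
  (1 < a)%N -> (1 < b)%N -> (1 < c)%N -> prime a.
Proof.
move=> ps s3 e a1 b1 c1; apply: contraTT s3 => na; rewrite -ltnNge.
have [x xa /andP[x1 x2]] : exists2 x, (x %| a)%N & (1 < x < a)%N.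
  exists (pdiv a); first exact: pdiv_dvd.
  rewrite prime_gt1 ?pdiv_prime //= ltn_neqAle pdiv_leq ?(ltnW a1) // andbT.
  by apply: contraNneq na => <-; apply: pdiv_prime.

have := @leq_size_factorization s [:: x; a %/ x; b; c]%N ps; apply.
  by have := divnK xa; rewrite /= b1 c1 x1 !andbT /=; nia.
by rewrite e !big_cons big_nil muln1 !mulnA [(x * _)%N]mulnC divnK.
Qed.

Section TwoPeriods.
Variables (R : realType) (n : nat).
Hypothesis n_gt1 : (1 < n)%N.
Variable E : {set 'Z_n}.
Implicit Types (k u v x y : 'Z_n).

Let f := fun x => (chi R E x)%:C.
Let A := fourier_supp f.

Lemma fourier_supp0 k : k \notin A -> fourier f k = 0.
Proof. by rewrite inE negbK => /eqP. Qed.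

Lemma supp_period u : (forall x, (x + u \in E) = (x \in E)) ->
  forall k, k \in A -> u * k = 0.
Proof.
move=> per k; rewrite inE => kA; apply/eqP; rewrite -(chr_eq1 R n_gt1).
apply/eqP/(mulIf kA); rewrite mul1r -[LHS]fourier_shift //.
by apply: eq_bigr => x _; rewrite /f /chi per.
Qed.

Lemma mixed_difference u v : (forall k, k \in A -> (u * k == 0) || (v * k == 0)) ->
  forall x, (((x + u + v)%R \in E) + (x \in E) = ((x + u)%R \in E) + ((x + v)%R \in E))%N.
Proof.
move=> uv x; pose fs w y := f (y + w).
have : (fun y => (fs (u + v) y - fs u y) - (fs v y - f y)) =1 (fun=> 0).
  apply: (fourier_inj n_gt1) => k; rewrite !fourierB /fs !fourier_shift //.
  rewrite [RHS]big1 => [|j _]; last by rewrite mul0r.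
  rewrite mulrDl chrD //.
  have [/uv/orP[]/eqP -> |/fourier_supp0 ->] := boolP (k \in A); rewrite ?chr0 //; ring.
move/(_ x); rewrite /fs addrA /f /chi => /(congr1 (@complex.Re R)) /= e.
by apply/eqP; rewrite -(eqr_nat R) !natrD; apply/eqP; move: e; lra.
Qed.

Lemma sum_bool_between (p : nat) (b : nat -> bool) : (1 < p)%N -> b 0%N != b 1%N ->
  (0 < \sum_(i < p) b i < p)%N.
Proof.
case: p => [|[|p]] // _ b01; rewrite !big_ord_recl /=.
set s := (\sum_(i < p) _)%N.
have : (s <= p)%N.
  by rewrite -[X in (_ <= X)%N]card_ord -sum1_card leq_sum // => i _; case: (b _).
rewrite /bump /= addn0; case: (b 0%N) (b 1%N) b01 => [] [] //= _; lia.
Qed.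

Lemma block_count (p q : nat) u v x : (1 < p)%N ->
  (forall k, k \in A -> (u * k == 0) || (v * k == 0)) ->
  (x + u \in E) != (x \in E) ->
  exists2 s, (\sum_(i < p) \sum_(j < q) ((x + u *+ i + v *+ j)%R \in E) = q * s)%N
           & (0 < s < p)%N.
Proof.
move=> p1 uv xu; exists (\sum_(i < p) ((x + u *+ i)%R \in E))%N; last first.
  apply: (@sum_bool_between p (fun i => x + u *+ i \in E)) => //.
  by rewrite mulr0n addr0 eq_sym.
have uv' i j k : k \in A -> (u *+ i * k == 0) || (v *+ j * k == 0).
  by move=> /uv/orP[]/eqP e; rewrite !mulrnAl e mul0rn eqxx ?orbT.
(* A jump of the 0-1 valued indicator along u determines its value, so a
   translate by v, which has the same jump, has the same value. *)
have xv j : (x + v *+ j \in E) = (x \in E).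
  have := mixed_difference (uv' 1%N j) x; rewrite mulr1n.
  by move: xu; do 4 case: (_ \in E).
rewrite big_distrr /=; apply: eq_bigr => i _.
rewrite -[q in RHS]card_ord -sum1_card big_distrl /=; apply: eq_bigr => j _.
have := mixed_difference (uv' i j) x; rewrite xv mul1n.
by do 3 case: (_ \in E).
Qed.

Lemma zero_one_support (p q : nat) u v : prime p -> prime q -> p != q ->
  u *+ p = 0 -> v *+ q = 0 ->
  (forall k, k \in A -> k != 0 -> (u * k == 0) = (v * k != 0)) ->
  (forall k, k \in A -> u * k = 0) \/ (forall k, k \in A -> v * k = 0).
Proof.
move=> pp pq npq up vq uv.
have [/forallP per|] := boolP [forall x, (x + u \in E) == (x \in E)].
  by left; apply: supp_period => x; apply/eqP.
case/forallPn=> x0 xu.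
have [/forallP per|] := boolP [forall x, (x + v \in E) == (x \in E)].
  by right; apply: supp_period => x; apply/eqP.
case/forallPn=> y0 yv; exfalso.
have uv' k : k \in A -> (u * k == 0) || (v * k == 0).
  have [->|k0] := eqVneq k 0; first by rewrite mulr0 eqxx.
  by move=> kA; rewrite uv //; case: eqP.
have vu' k : k \in A -> (v * k == 0) || (u * k == 0) by rewrite orbC; apply: uv'.
pose N x := (\sum_(i < p) \sum_(j < q) ((x + u *+ i + v *+ j)%R \in E))%N.
have Nconst x : N x = N 0.
  pose S y : R[i] := \sum_(i < p) \sum_(j < q) f (y + (u *+ i + v *+ j)).
  have FS k : fourier S k = (\sum_(i < p) chr R (u * k) ^+ i) *
      (\sum_(j < q) chr R (v * k) ^+ j) * fourier f k.
    have chrX w m : chr R (w *+ m * k) = chr R (w * k) ^+ m.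
      by elim: m => [|m IH]; rewrite ?mul0r ?chr0 // mulrS mulrDl chrD // IH exprS.
    rewrite fourierE // /S; under eq_bigr do rewrite mulr_suml.
    rewrite exchange_big mulr_suml mulr_suml /=; apply: eq_bigr => i _.
    under eq_bigr do rewrite mulr_suml.
    rewrite exchange_big [_ * \sum_(j < q) _]mulr_sumr mulr_suml /=; apply: eq_bigr => j _.
    by rewrite -fourierE // fourier_shift // mulrDl chrD // !chrX.
  have FS0 k : k != 0 -> fourier S k = 0.
    move=> k0; rewrite FS.
    have [kA|/fourier_supp0 ->] := boolP (k \in A); last by rewrite mulr0.
    have root w m : w *+ m = 0 -> w * k != 0 -> \sum_(i < m) chr R (w * k) ^+ i = 0.
      move=> wm wk; apply: geom_sum0; first by rewrite chr_eq1.
      have -> : chr R (w * k) ^+ m = chr R (w *+ m * k).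
        by elim: (m) => [|l IH]; rewrite ?mul0r ?chr0 // mulrS mulrDl chrD // exprS IH.
      by rewrite wm mul0r chr0.
    have := uv k kA k0; have [vk|vk] := eqVneq (v * k) 0 => /= uk.
      by rewrite (root u p up) ?uk // !mul0r.
    by rewrite (root v q vq) // mulr0 mul0r.
  have SE y : S y = (N y)%:R.
    rewrite /S /N natr_sum; apply: eq_bigr => i _; rewrite natr_sum.
    by apply: eq_bigr => j _; rewrite /f /chi addrA; case: (_ \in E).
  have : (fun y => S (y + x) - S y) =1 (fun=> 0).
    apply: (fourier_inj n_gt1) => k; rewrite fourierB fourier_shift //.
    rewrite [RHS]big1 => [|j _]; last by rewrite mul0r.
    by have [->|/FS0 ->] := eqVneq k 0; rewrite ?mulr0 ?chr0 ?mul1r subrr.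
  by move/(_ 0)/eqP; rewrite add0r subr_eq0 !SE eqr_nat => /eqP.
have [s Ns /andP[s0 sp]] := block_count q (prime_gt1 pp) uv' xu.
have [t Nt _] := block_count p (prime_gt1 pq) vu' yv.
have e : (q * s = p * t)%N.
  rewrite -Ns -[LHS]/(N x0) -Nt Nconst -(Nconst y0) /N exchange_big.
  by apply: eq_bigr => j _; apply: eq_bigr => i _; rewrite addrAC.
have : (p %| q * s)%N by rewrite e dvdn_mulr.
rewrite Euclid_dvdM // dvdn_prime2 // (negPf npq) => /(dvdn_leq s0).
by rewrite leqNgt sp.
Qed.

End TwoPeriods.

Lemma coprimez_prime (a : nat) (z : int) : prime a -> coprimez z a = ~~ (a %| z)%Z.
Proof.
by move=> pa; rewrite coprimezE absz_nat coprime_sym prime_coprime // dvdzE.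
Qed.

Lemma coprimez_lin (a b : nat) (m : int) : prime a -> prime b -> a != b ->
  ~~ (b %| m)%Z -> coprimez (m * a%:Z + b%:Z) (a * b)%N.
Proof.
move=> pa pb nab bm; rewrite PoszM coprimezMr !coprimez_prime //; apply/andP; split.
  by rewrite rpredDl ?dvdz_mull // dvdzE !absz_nat dvdn_prime2.
rewrite rpredDr ?dvdzz // Gauss_dvdzl // coprimez_sym coprimez_prime //.
by rewrite dvdzE !absz_nat dvdn_prime2 // eq_sym.
Qed.

Section OddSupport.
Variables (R : realType) (n : nat).
Hypotheses (n_gt1 : (1 < n)%N) (n_odd : odd n).
Variable E : {set 'Z_n}.
Hypothesis E_neq0 : E != set0.
Implicit Types (k : 'Z_n) (a b : int) (d : nat).

Let f := fun x => (chi R E x)%:C.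
Let A := fourier_supp f.

Let n_neq0 : n%:R != 0 :> R. Proof. by rewrite pnatr_eq0 -lt0n ltnW. Qed.
Let n_gt0 : (0 < n)%N := ltnW n_gt1.
Let n_gt2 : (2 < n)%N. Proof. by case: n n_gt1 n_odd => [|[|[|]]]. Qed.

Lemma chrN1_primitive : n.-primitive_root (chr R (- (1 : 'Z_n))).
Proof.
have [|m mp mn] := @prim_order_exists _ n (chr R (- (1 : 'Z_n))) n_gt0.
  by apply/eqP; rewrite chrN_expr_eq1 // dvdn_mull.
have := prim_expr_order mp => /eqP; rewrite chrN_expr_eq1 // (val_Zn_nat n_gt2 1).
rewrite modn_small // mul1n => nm.
have e : m = n by apply/eqP; rewrite eqn_dvd mn nm.
by move: mp; rewrite e.
Qed.

Lemma supp_gcd (k l : 'Z_n) : gcdn k n = gcdn l n -> k \in A -> l \in A.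
Proof.
move=> e; rewrite !inE; apply: contraNN.
have chrE (x : 'Z_n) : chr R (- x) = chr R (- (1 : 'Z_n)) ^+ x.
  rewrite -{1}(natr_Zp x); elim: (nat_of_ord x) => [|m IH]; first by rewrite oppr0 chr0.
  by rewrite exprS -IH -chrD // -opprD [m.+1%:R]mulrS.
pose P : {poly int} := \poly_(j < n) ((j%:R : 'Z_n) \in E : nat)%:Z.
have FE x : fourier f x = (map_poly intr P).[chr R (- x)].
  have := @fourier_indicator R n n_gt2 (fun j => (j%:R : 'Z_n) \in E) x.
  have -> : [set x : 'Z_n | (nat_of_ord x)%:R \in E] = E.
    by apply/setP => y; rewrite inE natr_Zp.
  rewrite -/f => ->.
  rewrite (horner_coef_wide (n := n)); last first.
    by apply: leq_trans (size_poly _ _) (size_poly _ _).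
  apply: eq_bigr => j _; rewrite coef_map coef_poly ltn_ord /=.
  by case: (_ \in E).
rewrite !FE -!rootE => root_l.
have prim (x : 'Z_n) : (n %/ gcdn x n).-primitive_root (chr R (- x)).
  by rewrite chrE; apply: exp_prim_root chrN1_primitive _.
by apply: int_poly_root_conjugate (prim l) _ root_l; rewrite -e.
Qed.

Let Z a : 'Z_n := a%:~R.

Lemma gcd_val_intr a : gcdn (Z a) n = gcdn `|a| n.
Proof.
have gcdN (x : 'Z_n) : gcdn (- x)%R n = gcdn x n.
  have [->|x0] := eqVneq x 0; first by rewrite oppr0.
  have gcdn_sum (u v m : nat) : (u + v)%N = m -> gcdn v m = gcdn u m.
    by move=> <-; rewrite gcdnDl [(u + v)%N]addnC gcdnDl gcdnC.
  exact: gcdn_sum (val_ZnN n_gt1 x0).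
case: a => m; first by rewrite /Z -pmulrn val_Zn_nat // gcdn_modl.
by rewrite /Z NegzE mulrNz gcdN -pmulrn val_Zn_nat // gcdn_modl abszN.
Qed.

Lemma intr_val k : Z (k : nat) = k.
Proof. by rewrite /Z -pmulrn natr_Zp. Qed.

Lemma mem_supp_gcd a b : gcdn `|a| n = gcdn `|b| n -> Z a \in A -> Z b \in A.
Proof. by move=> e; apply: supp_gcd; rewrite !gcd_val_intr. Qed.

Lemma mem_supp_coprime d a : (d %| n)%N -> Z d \in A -> coprimez a (n %/ d)%N ->
  Z (d%:Z * a) \in A.
Proof.
move=> dn dA cop; apply: mem_supp_gcd dA.
rewrite abszM absz_nat (gcdn_idPl dn) -[X in gcdn _ X](divnK dn).
by move: cop; rewrite coprimezE absz_nat mulnC -muln_gcdl => /eqP ->; rewrite mul1n.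
Qed.

Variable h : 'Z_n -> circle R.
Hypothesis h_add : additive_on A h.

Let A0 : 0 \in A. Proof. by rewrite supp0. Qed.

Lemma h_linear d a : (d %| n)%N -> Z d \in A -> Z (d%:Z * a) \in A ->
  h (Z (d%:Z * a)) = h (Z d) *~ a.
Proof.
move=> dn dA daA.
rewrite -[in RHS](mulr1 d%:Z).
apply: (@odd_units_linear _ (n %/ d) (fun x => Z (d%:Z * x) \in A)
  (fun x => h (Z (d%:Z * x)))) => //.
- by apply: dvdn_odd n_odd; apply: dvdn_div.
- by move=> x; apply: mem_supp_coprime.
- by rewrite mulr0.
- move=> x y; rewrite mulrDr {3 4}/Z intrD; exact: h_add.
Qed.

(* An additive h sends j d to T j d / n mod 1. *)
Definition slope d (T : int) := h (Z d) = mod1 (T%:~R * d%:R / n%:R).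

Lemma slope_exists d : (d %| n)%N -> Z d \in A -> exists T, slope d T.
Proof.
move=> dn dA; have [x hx] := mod1_surj (h (Z d)).
have : h (Z (d%:Z * (n %/ d)%N)) = h (Z d) *~ (n %/ d)%N.
  apply: h_linear => //; rewrite -PoszM mulnC divnK //.
  by rewrite /Z -pmulrn pchar_Zp.
rewrite -PoszM mulnC divnK // {1}/Z -pmulrn pchar_Zp // (additive_on0 A0 h_add) //.
rewrite hx -mod1_mulrz => /esym/eqP; rewrite mod1_eq0 => /intrP[T TE].
exists T; rewrite /slope hx; congr mod1.
have nd : n%:R = (n %/ d)%N%:R * d%:R :> R by rewrite -natrM divnK.
have d0 : d%:R != 0 :> R by rewrite pnatr_eq0 -lt0n (dvdn_gt0 n_gt0).
have nd0 : (n %/ d)%N%:R != 0 :> R.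
  by apply: contraNneq n_neq0 => e; rewrite nd e mul0r.
rewrite -TE nd -mulrzl -pmulrn; field.
by rewrite nd0 d0.
Qed.

Lemma slope_mul d T a : (d %| n)%N -> Z d \in A -> Z (d%:Z * a) \in A -> slope d T ->
  h (Z (d%:Z * a)) = mod1 (T%:~R * (d%:Z * a)%:~R / n%:R).
Proof.
move=> dn dA aA hd; rewrite h_linear // hd -mod1_mulrz; congr mod1.
by rewrite -mulrzl intrM -pmulrn; ring.
Qed.

Lemma mod1_frac (x y : int) : mod1 (x%:~R / n%:R : R) = mod1 (y%:~R / n%:R) ->
  (n %| x - y)%Z.
Proof.
move/eqP; rewrite mod1_eq -mulrBl -intrB => /intrP[t e].
apply/dvdzP; exists t; apply: (@intr_inj R).
by rewrite [RHS]intrM -e -pmulrn divfK.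
Qed.

Lemma slope_compatible d d' l T T' : (l %| n)%N -> (d %| l)%N -> (d' %| l)%N ->
  Z d \in A -> Z d' \in A -> Z l \in A -> slope d T -> slope d' T' ->
  ((n %/ l)%N %| T - T')%Z.
Proof.
move=> ln dl d'l dA d'A lA hd hd'.
have lE := slope_mul (a := (l %/ d)%N) (dvdn_trans dl ln) dA _ hd.
have lE' := slope_mul (a := (l %/ d')%N) (dvdn_trans d'l ln) d'A _ hd'.
move: lE lE'; rewrite -!PoszM [(d * _)%N]mulnC [(d' * _)%N]mulnC !divnK //.
move=> /(_ lA) -> /(_ lA).
rewrite -!intrM => /mod1_frac; rewrite -mulrBl -{1}(divnK ln) PoszM dvdz_mul2r //.
by rewrite -lt0n (dvdn_gt0 n_gt0).
Qed.

Lemma extendable_of_slopes :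
  (forall d d' T T', (d %| n)%N -> (d' %| n)%N -> Z d \in A -> Z d' \in A ->
    slope d T -> slope d' T' -> Z (lcmn d d') \notin A ->
    ((n %/ lcmn d d')%N %| T - T')%Z) ->
  exists L : R, forall k, k \in A -> h k = mod1 (L * k%:R).
Proof.
move=> compat.
pose s := [seq d : nat <- divisors n | Z d \in A].
have sP d : d \in s -> (d %| n)%N /\ Z d \in A.
  by rewrite mem_filter -dvdn_divisors // => /andP[].
have [T TE] : exists T : nat -> int, {in s, forall d, slope d (T d)}.
  have : forall d, d \in s -> exists t, slope d t.
    by move=> d /sP[dn dA]; apply: slope_exists.
  elim: (s) => [|d t IH] H; first by exists (fun=> 0).
  have [|T TE] := IH; first by move=> e et; apply: H; rewrite inE et orbT.
  have [t0 t0E] := H d (mem_head _ _).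
  exists (fun e => if e == d then t0 else T e) => e; rewrite inE.
  by case: eqP => [->|_] //= et; apply: TE.
have [|x xE] := @chinese_compatible s (fun d => n %/ d)%N T.
  move=> d d' ds d's; have [dn dA] := sP d ds; have [d'n d'A] := sP d' d's.
  have lA : ((n %/ lcmn d d')%N %| T d - T d')%Z.
    have [lA|lA] := boolP (Z (lcmn d d') \in A).
      apply: (slope_compatible (l := lcmn d d') (d := d) (d' := d'));
        rewrite ?dvdn_lcm ?dn ?dvdn_lcml ?dvdn_lcmr //; exact: TE.
    by apply: compat => //; apply: TE.
  apply: dvdz_trans lA; rewrite dvdzE !absz_nat.
  have d0 : (0 < d)%N := dvdn_gt0 n_gt0 dn.
  have ln : (lcmn d d' %| n)%N by rewrite dvdn_lcm dn.
  rewrite dvdn_divRL // muln_lcmr dvdn_lcm -!dvdn_divRL //.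
  by rewrite dvdn_gcdl dvdn_gcdr.
exists (x%:~R / n%:R) => k kA.
pose d := gcdn k n.
have dn : (d %| n)%N := dvdn_gcdr _ _.
have dA : Z d \in A.
  by apply: (supp_gcd (k := k)) => //; rewrite gcd_val_intr absz_nat (gcdn_idPl dn).
have ds : d \in s by rewrite mem_filter dA -dvdn_divisors.
have kE : Z (d%:Z * (k %/ d)%N) = k.
  by rewrite -PoszM mulnC divnK ?dvdn_gcdl // intr_val.
have := slope_mul (a := (k %/ d)%N) dn dA; rewrite kE => /(_ _ kA (TE d ds)) ->.
apply/eqP; rewrite mod1_eq -PoszM mulnC divnK ?dvdn_gcdl // -pmulrn.
have [t tE] := dvdzP (xE d ds).
have -> : (T d)%:~R * k%:R / n%:R - x%:~R / n%:R * k%:R =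
    - (x - T d)%:~R * k%:R / n%:R :> R.
  by rewrite intrB; field.
have nd : n%:R = (n %/ d)%N%:R * d%:R :> R by rewrite -natrM divnK.
have kd : k%:R = (k %/ d)%N%:R * d%:R :> R by rewrite -natrM divnK ?dvdn_gcdl.
have d0 : d%:R != 0 :> R by rewrite pnatr_eq0 -lt0n (dvdn_gt0 n_gt0).
have nd0 : (n %/ d)%N%:R != 0 :> R.
  by apply: contraNneq n_neq0 => e; rewrite nd e mul0r.
rewrite tE intrM -pmulrn nd kd.
have -> : - (t%:~R * (n %/ d)%:R) * ((k %/ d)%:R * d%:R) / ((n %/ d)%:R * d%:R) =
    - (t%:~R * (k %/ d)%:R) :> R.
  by field; rewrite nd0 d0.
by rewrite rpredN rpredM ?intr_int ?natr_int.
Qed.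

Lemma slope_prime_compatible (p q r : nat) (T T' : int) :
  n = (p * q * r)%N -> prime p -> prime q -> prime r -> p != q ->
  Z p \in A -> Z q \in A -> Z (p * q)%N \notin A ->
  slope p T -> slope q T' -> (r %| T - T')%Z.
Proof.
move=> nE pp pq pr npq pA qA pqA hp hq.
have [p0 q0 r0] := And3 (prime_gt0 pp) (prime_gt0 pq) (prime_gt0 pr).
have pn : (p %| n)%N by rewrite nE -mulnA dvdn_mulr.
have qn : (q %| n)%N by rewrite nE mulnAC dvdn_mull.
have rn : (r %| n)%N by rewrite nE dvdn_mull.
have np : (n %/ p)%N = (q * r)%N by rewrite nE -mulnA mulKn.
have nq : (n %/ q)%N = (p * r)%N by rewrite nE mulnAC mulnK.
have [A1|A1] := boolP (Z 1 \in A).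
  have [t ht] := slope_exists (dvd1n n) A1.
  have c1 := slope_compatible pn (dvd1n p) (dvdnn p) A1 pA pA ht hp.
  have c2 := slope_compatible qn (dvd1n q) (dvdnn q) A1 qA qA ht hq.
  rewrite -(subrKA t) rpredD //.
    by rewrite -rpredN opprB; apply: dvdz_trans c1; rewrite np dvdzE !absz_nat dvdn_mull.
  by apply: dvdz_trans c2; rewrite nq dvdzE !absz_nat dvdn_mull.
have pP x : coprimez x (q * r)%N -> Z (p%:Z * x) \in A.
  by move=> cop; apply: mem_supp_coprime; rewrite ?np.
have qP x : coprimez x (p * r)%N -> Z (q%:Z * x) \in A.
  by move=> cop; apply: mem_supp_coprime; rewrite ?nq.
have [rA|rA] := boolP [&& r != p, r != q & Z r \in A].
  have /and3P[rp rq {}rA] := rA.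
  have [t ht] := slope_exists rn rA.
  have np' : p != r by rewrite eq_sym.
  have nq' : q != r by rewrite eq_sym.
  (* r (p + q) = p (m q + r) + q (r - m p), used for m = 1 and m = 2. *)
  have rel (m : int) : ~~ (r %| m)%Z ->
      (n %| t * (r%:Z * (p%:Z + q%:Z)) -
            (T * (p%:Z * (m * q%:Z + r%:Z)) + T' * (q%:Z * (- m * p%:Z + r%:Z))))%Z.
    move=> rm.
    have xA := pP _ (coprimez_lin pq pr nq' rm).
    have yA : Z (q%:Z * (- m * p%:Z + r%:Z)) \in A.
      by apply: qP; apply: coprimez_lin; rewrite ?dvdzN ?rpredN.
    have e : r%:Z * (p%:Z + q%:Z) =
        p%:Z * (m * q%:Z + r%:Z) + q%:Z * (- m * p%:Z + r%:Z) by ring.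
    have sA : Z (r%:Z * (p%:Z + q%:Z)) \in A.
      apply: mem_supp_coprime => //.
      rewrite (_ : n %/ r = p * q)%N; last by rewrite nE mulnK.
      rewrite -[p%:Z]mul1r; apply: coprimez_lin => //.
      by rewrite dvdzE absz_nat dvdn1 neq_ltn prime_gt1 ?orbT.
    apply: mod1_frac; rewrite [in LHS]intrM -(slope_mul rn rA sA ht).
    rewrite intrD !mulrDl mod1D [in LHS]e.
    rewrite [(T * _)%:~R]intrM [(T' * _)%:~R]intrM.
    rewrite -(slope_mul pn pA xA hp) -(slope_mul qn qA yA hq).
    have ZD : Z (r%:Z * (p%:Z + q%:Z)) =
        Z (p%:Z * (m * q%:Z + r%:Z)) + Z (q%:Z * (- m * p%:Z + r%:Z)).
      by rewrite e /Z intrD.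
    by rewrite -e ZD; apply: h_add => //; rewrite -ZD.
  have r2 : ~~ (r %| 2%:Z)%Z.
    rewrite dvdzE !absz_nat; apply/negP => /dvdn_leq => /(_ isT) r2.
    have r2' : r = 2 by apply/eqP; rewrite eqn_leq r2 prime_gt1.
    by have := dvdn_odd rn n_odd; rewrite r2'.
  have r1 : ~~ (r %| 1%:Z)%Z.
    by rewrite dvdzE !absz_nat dvdn1 neq_ltn prime_gt1 ?orbT.
  have := rpredB (rel _ r1) (rel _ r2).
  have -> : t * (r%:Z * (p%:Z + q%:Z)) -
            (T * (p%:Z * (1%:Z * q%:Z + r%:Z)) + T' * (q%:Z * (- 1%:Z * p%:Z + r%:Z))) -
      (t * (r%:Z * (p%:Z + q%:Z)) -
            (T * (p%:Z * (2%:Z * q%:Z + r%:Z)) + T' * (q%:Z * (- 2%:Z * p%:Z + r%:Z))))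
     = (p * q)%N%:Z * (T - T') by rewrite PoszM; ring.
  by rewrite nE (PoszM (p * q) r) dvdz_mul2l // -lt0n muln_gt0 p0.
exfalso.
have cpq : coprime p q by rewrite prime_coprime // dvdn_prime2.
have Zmul0 (m d : nat) (k : 'Z_n) : n = (d * m)%N -> (Z m * k == 0) = (d %| k)%N.
  move=> e; rewrite /Z -pmulrn mulr_natl Zn_mulrn_eq0 // {1}e dvdn_pmul2r //.
  by case: m e n_gt0 => // ->; rewrite muln0.
have up (k : 'Z_n) : (Z (q * r)%N * k == 0) = (p %| k)%N by apply: Zmul0; rewrite nE mulnA.
have vq (k : 'Z_n) : (Z (p * r)%N * k == 0) = (q %| k)%N by apply: Zmul0; rewrite nE; ring.
have nZ m d : n = (m * d)%N -> Z m *+ d = 0.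
  by move=> e; rewrite /Z -pmulrn -mulrnA -e pchar_Zp.
have gA (k : 'Z_n) : k \in A -> Z (gcdn k n) \in A.
  apply: supp_gcd; rewrite gcd_val_intr absz_nat.
  by rewrite (gcdn_idPl (dvdn_gcdr k n)).
have split (k : 'Z_n) : k \in A -> k != 0 ->
    (Z (q * r)%N * k == 0) = (Z (p * r)%N * k != 0).
  move=> kA k0; rewrite up vq.
  have gn := dvdn_gcdr k n; have gk := dvdn_gcdl k n; have {}gA := gA k kA.
  have [pk|pk] := boolP (p %| k)%N; have [qk|qk] := boolP (q %| k)%N => //=; exfalso.
    have : (p * q %| gcdn k n)%N.
      by rewrite dvdn_gcd Gauss_dvd // pk qk nE dvdn_mulr.
    case/dvdnP => j gE; rewrite gE in gA gn gk.
    have jr : (j %| r)%N by move: gn; rewrite nE mulnC dvdn_pmul2l // muln_gt0 p0.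
    case/(primeP pr).2/orP: jr => /eqP jE; rewrite jE in gA gk.
      by rewrite mul1n (negPf pqA) in gA.
    have nE' : (r * (p * q))%N = n by rewrite nE mulnC.
    have nk : (n %| k)%N by rewrite -{1}nE'.
    have k_gt0 : (0 < k)%N.
      by rewrite lt0n; apply: contra_neq k0 => k0; apply: val_inj.
    by have := dvdn_leq k_gt0 nk; rewrite leqNgt ltn_Zn.
  have : (gcdn k n %| r)%N.
    rewrite -(@Gauss_dvdr _ (p * q)); first by rewrite -nE.
    rewrite coprimeMr.
    rewrite ![coprime (gcdn k n) _]coprime_sym !prime_coprime //; apply/andP; split.
      by apply: contra pk => /dvdn_trans; apply.
    by apply: contra qk => /dvdn_trans; apply.
  case/(primeP pr).2/orP => /eqP gE; rewrite gE in gA gk.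
    by rewrite gA in A1.
  case/negP: rA; rewrite gA andbT.
  by apply/andP; split; [apply: contraNneq pk | apply: contraNneq qk] => <-.
have nqp : ~~ (q %| p)%N by rewrite dvdn_prime2 // eq_sym.
have npq' : ~~ (p %| q)%N by rewrite dvdn_prime2.
have valZ m : (m < n)%N -> nat_of_ord (Z m) = m.
  by move=> mn; rewrite /Z -pmulrn val_Zn_nat // modn_small.
have pltn : (p < n)%N.
  apply: leq_trans (ltn_Pmulr (prime_gt1 pq) p0) _.
  by rewrite nE leq_pmulr.
have qltn : (q < n)%N.
  apply: leq_trans (ltn_Pmull (prime_gt1 pp) q0) _.
  by rewrite nE leq_pmulr.
have Zqr : Z (q * r)%N *+ p = 0 by apply: nZ; rewrite nE; ring.
have Zpr : Z (p * r)%N *+ q = 0 by apply: nZ; rewrite nE; ring.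
have [H|H] := zero_one_support n_gt1 pp pq npq Zqr Zpr split.
  by have /eqP := H _ qA; rewrite up valZ // (negPf npq').
by have /eqP := H _ pA; rewrite vq valZ // (negPf nqp).
Qed.

End OddSupport.

Lemma few_odd_primes_odd n : few_odd_primes n -> odd n.
Proof.
case=> [[p [k [/andP[op _] ->]]]|[s [_ os ->]]]; first by rewrite oddX op orbT.
elim: s os => [|p s IH] /=; first by rewrite big_nil.
by case/andP=> /andP[op _] os; rewrite big_cons oddM op IH.
Qed.

Lemma few_odd_primes_extendable (R : realType) (n : nat) : (2 < n)%N ->
  few_odd_primes n ->
  forall E : {set 'Z_n}, extendable R (fourier_supp (fun x => (chi R E x)%:C)).
Proof.
move=> n_gt2 few E; have n_gt1 := ltnW n_gt2; have n_gt0 := ltnW n_gt1.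
have n_odd := few_odd_primes_odd few.
have [E0|E0] := eqVneq E set0; first exact: fourier_empty.
move=> h hadd; apply: (extendable_of_slopes n_gt1 n_odd E0 hadd).
move=> d d' T T' dn d'n dA d'A hd hd' lA.
have ndd' : ~~ (d %| d')%N.
  by apply: contraNN lA => dd'; rewrite (_ : lcmn d d' = d') //; apply/lcmn_idPr.
have nd'd : ~~ (d' %| d)%N.
  by apply: contraNN lA => dd'; rewrite (_ : lcmn d d' = d) //; apply/lcmn_idPl.
case: few => [[p [k [/andP[_ pp] nE]]]|[s [s3 os nE]]].
  have [i _ dE] : exists2 i, (i <= k)%N & d = (p ^ i)%N.
    by apply/dvdn_pfactor => //; rewrite -nE.
  have [j _ d'E] : exists2 j, (j <= k)%N & d' = (p ^ j)%N.
    by apply/dvdn_pfactor => //; rewrite -nE.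
  by move: ndd' nd'd; rewrite dE d'E; case/orP: (leq_total i j) => /(dvdn_exp2l p) ->.
have ps : all prime s by apply: sub_all os => p /andP[].
set l := lcmn d d' in lA *.
have dl : (d %| l)%N := dvdn_lcml d d'.
have d'l : (d' %| l)%N := dvdn_lcmr d d'.
have ln : (l %| n)%N by rewrite dvdn_lcm dn.
have d_gt0 := dvdn_gt0 n_gt0 dn; have d'_gt0 := dvdn_gt0 n_gt0 d'n.
have l_gt0 := dvdn_gt0 n_gt0 ln.
have gt1 x : (0 < x)%N -> x != 1%N -> (1 < x)%N by case: x => [|[]].
have d1 : (1 < d)%N by apply: gt1 => //; apply: contraNneq ndd' => ->; rewrite dvd1n.
have d'1 : (1 < d')%N by apply: gt1 => //; apply: contraNneq nd'd => ->; rewrite dvd1n.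
have nl1 : (1 < n %/ l)%N.
  apply: gt1; first by rewrite divn_gt0 // dvdn_leq.
  apply: contraNneq lA => e.
  have -> : l = n by rewrite -(divnK ln) e mul1n.
  by rewrite -pmulrn pchar_Zp // supp0.
have ld1 : (1 < l %/ d)%N.
  apply: gt1; first by rewrite divn_gt0 // dvdn_leq // dvdn_lcml.
  apply: contraNneq nd'd => e.
  have -> : d = l by rewrite -[RHS](divnK dl) e mul1n.
  exact: dvdn_lcmr.
have ld'1 : (1 < l %/ d')%N.
  apply: gt1; first by rewrite divn_gt0 // dvdn_leq // dvdn_lcmr.
  apply: contraNneq ndd' => e.
  have -> : d' = l by rewrite -[RHS](divnK d'l) e mul1n.
  exact: dvdn_lcml.
have fac1 : n = (d * (l %/ d) * (n %/ l))%N.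
  by rewrite [(d * _)%N]mulnC (divnK dl) mulnC divnK.
have fac2 : n = (d' * (l %/ d') * (n %/ l))%N.
  by rewrite [(d' * _)%N]mulnC (divnK d'l) mulnC divnK.
have dp : prime d.
  by apply: (three_factors_prime (c := (n %/ l)%N) ps s3 _ d1 ld1) => //; rewrite -nE.
have d'p : prime d'.
  by apply: (three_factors_prime (c := (n %/ l)%N) ps s3 _ d'1 ld'1) => //; rewrite -nE.
have rp : prime (n %/ l).
  apply: (three_factors_prime ps s3 _ nl1 d1 ld1).
  by rewrite -nE {1}fac1 mulnC mulnA.
have ndd : d != d' by apply: contraNneq ndd' => ->.
have lE : l = (d * d')%N.
  have := muln_lcm_gcd d d'.
  have /eqP -> : coprime d d' by rewrite prime_coprime // dvdn_prime2.
  by rewrite muln1.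
apply: (slope_prime_compatible n_gt1 n_odd E0 hadd (p := d) (q := d')) => //.
  by rewrite -lE mulnC divnK.
by rewrite -lE.
Qed.

Lemma extendable_few_odd_primes (R : realType) (n : nat) : (2 < n)%N ->
  (forall E : {set 'Z_n}, extendable R (fourier_supp (fun x => (chi R E x)%:C))) ->
  few_odd_primes n.
Proof.
move=> n_gt2 ext; case: (factor_cases n_gt2) => //
  [en|[p [q [r [s [nE cpq p1 q1 /andP[r1 s1]]]]]]].
  by have [E []] := even_not_extendable R n_gt2 en.
by have [E []] := four_factors_not_extendable R n_gt2 nE cpq p1 q1 r1 s1.
Qed.

Theorem theorem4 (R : realType) (n : nat) (n_ge3 : (3 <= n)%N) :
  let stmt_i :=
    (exists p k : nat, odd_prime p /\ n = (p ^ k)%N) \/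
    (exists s : seq nat,
       [/\ (size s <= 3)%N, all odd_prime s & n = (\prod_(p <- s) p)%N]) in
  let stmt_ii :=
    forall E : {set 'Z_n},
      extendable R (fourier_supp (fun x => (chi R E x)%:C)) in
  let stmt_iii :=
    forall (E : {set 'Z_n}) (g : 'Z_n -> R),
      E != set0 ->
      (forall x1 x2 : 'Z_n, deck3 (chi R E) x1 x2 = deck3 g x1 x2) ->
      exists t : 'Z_n, forall x : 'Z_n, g x = chi R E (x - t) in
  (stmt_i <-> stmt_ii) /\ (stmt_ii <-> stmt_iii).
Proof.
move: n_ge3 => n_gt2 stmt_i stmt_ii stmt_iii; have n_gt1 := ltnW n_gt2.
split.
  by split; [apply: few_odd_primes_extendable | apply: extendable_few_odd_primes].
split=> [ext E g E0 decks|H E].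
  exact: (extendable_deck n_gt1 E0 (ext E) decks).
have [E0|E0] := eqVneq E set0; first exact: fourier_empty.
by apply: (deck_extendable n_gt1 E0) => g; apply: H.
Qed.
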